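(* Let $n\ge 2$ be an integer and let $f:[0,\infty)\to\mathbb{R}$. Put $F(s)=\int_0^s f(t)\,dt$. Assume: (1) $f$ is continuous on $[0,\infty)$, continuously differentiable on $(0,\infty)$, and $f'\in L^1(0,1)$; (2) $f(0)=0$ and there exist $\beta>B>0$ such that $f(s)>0$ for $s>B$, $f(s)\le 0$ for $s\in[0,B]$, $f(s)<0$ on $(0,\epsilon)$ for some $\epsilon>0$, and $\int_0^\beta f(t)\,dt=0$; (3) $\left(\frac{F}{f}\right)'(s)\ge\frac{n-2}{2n}$ for all $s>\beta$. Then for every $a$ with $0<a<\infty$ the problem $$u''(r)+\frac{n-1}{r}u'(r)+f(u(r))=0,\quad r\in(a,\infty),\qquad u(a)=0,\quad \lim_{r\to\infty}u(r)=0,$$ has at most one positive solution.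
   Context: A positive solution is a classical solution $u\in C^2(a,\infty)\cap C^1[a,\infty)$ of the problem with $u(r)>0$ for all $r\in(a,\infty)$. *)

(* Defs.v *)
From HB Require Import structures.
From mathcomp Require Import all_boot all_order all_algebra.
From mathcomp Require Import all_classical all_reals all_analysis.

Set Implicit Arguments.
Unset Strict Implicit.
Unset Printing Implicit Defensive.

Import Order.TTheory GRing.Theory Num.Theory.
Import numFieldNormedType.Exports.

Local Open Scope ring_scope.
Local Open Scope classical_set_scope.

(* Functions on [0, +oo[ or [a, +oo[ are represented by total functions R -> R;
   the values outside the interval are never constrained. *)

Definition primitive0 (R : realType) (f : R -> R) (s : R) : R :=
  Rintegral lebesgue_measure `[0, s] f.

Definition C1_oy (R : realType) (a : R) (g : R -> R) : Prop :=
  forall r : R, a < r -> derivable g r 1 /\ {for r, continuous g^`()}.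

Definition C2_oy (R : realType) (a : R) (g : R -> R) : Prop :=
  forall r : R, a < r ->
    [/\ derivable g r 1, derivable g^`() r 1 & {for r, continuous g^`(2)}].

(* At the endpoint a, dg a is the one-sided (right) derivative: the two-sided
   one would depend on the values of g on the left of a. *)
Definition C1_cy (R : realType) (a : R) (g : R -> R) : Prop :=
  exists dg : R -> R,
    [/\ forall r : R, a < r -> is_derive r 1 g (dg r),
        (g (a + h) - g a) / h @[h --> 0^'+] --> dg a &
        {within `[a, +oo[, continuous dg}].

Definition positive_solution (R : realType) (n : nat) (f : R -> R) (a : R)
    (u : R -> R) : Prop :=
  [/\ C2_oy a u /\ C1_cy a u,
      forall r : R, a < r -> 0 < u r,
      forall r : R, a < r ->
        u^`(2)%classic r + (n%:R - 1) / r * u^`()%classic r + f (u r) = 0,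
      u a = 0 &
      u r @[r --> +oo] --> 0].

(* Main.v *)
(* A positive solution u rises from u(a) = 0 to a single maximum above beta and
   then decreases to 0, since u'^2 + 2 F(u) is positive and nonincreasing in r.
   Each monotone piece is described by r(s) and y(s) = |u'| as functions of the
   value s = u, and two solutions are compared at equal values s. Let u1, u2
   have slopes u1'(a) < u2'(a).

   Rising pieces: y1 < y2 and r1 >= r2 all the way up. Below beta this follows
   from r^(2n-2) (y^2 + 2 F) and above beta from the flux V = r^(n-1) y. Hence
   max u1 < max u2, and the functional
     Q = r^n (u'^2 + 2 F(u)) + 2 n (F/f)(u) r^(n-1) u',
   for which dQ/ds = V (2 n (F/f)' - (n - 2)) up to the sign of u', is smaller
   for u1 than for u2 at s = max u1; condition (3) says that Q increases in r.

   Falling pieces, read downwards from s = max u1: as long as r1 <= r2 one has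
   y1 < y2, because (y2^2 - y1^2)^2 (r1 r2)^(n-1) increases; this quantity tends
   to 0 as s -> 0 if r1 <= r2 persists, so r1 >= r2 at some s. From there Q
   (and, once V1 > V2, the combination Q1 - (V1/V2) Q2) carries y1 < y2 and
   r1 >= r2 down to s = beta, where r1 y1 < r2 y2 results. Below beta the gap
   between the values of r sqrt (y^2 + 2 F) then grows as s -> 0, which
   contradicts liminf r y = 0.

   Solutions with equal slopes at a coincide by Gronwall's inequality. *)
Require Import Defs.
From HB Require Import structures.
From mathcomp Require Import all_boot all_order all_algebra.
From mathcomp Require Import all_classical all_reals all_analysis.
From mathcomp Require Import ring lra.

Import Order.TTheory GRing.Theory Num.Theory.
Import numFieldNormedType.Exports.

Local Open Scope ring_scope.
Local Open Scope classical_set_scope.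

(** * Calculus on the real line *)

Section Calculus.
Context {R : realType}.
Implicit Types (f g h : R -> R) (x a b c d : R).

Lemma deriv_add {f g x a b} : is_derive x 1 f a -> is_derive x 1 g b ->
  is_derive x 1 (fun s => f s + g s) (a + b).
Proof. by move=> ? ?; exact: is_deriveD. Qed.

Lemma deriv_sub {f g x a b} : is_derive x 1 f a -> is_derive x 1 g b ->
  is_derive x 1 (fun s => f s - g s) (a - b).
Proof. by move=> ? ?; exact: is_deriveB. Qed.

Lemma deriv_opp {f x a} : is_derive x 1 f a ->
  is_derive x 1 (fun s => - f s) (- a).
Proof. by move=> ?; exact: is_deriveN. Qed.

Lemma deriv_mul {f g x a b} : is_derive x 1 f a -> is_derive x 1 g b ->
  is_derive x 1 (fun s => f s * g s) (a * g x + f x * b).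
Proof.
move=> df dg.
have dfg : is_derive x 1 (f * g) (a * g x + f x * b).
  by apply: is_derive_eq; rewrite addrC [g x *: a]mulrC.
by rewrite mulrfctE in dfg.
Qed.

Lemma deriv_scale {f x a} k : is_derive x 1 f a ->
  is_derive x 1 (fun s => k * f s) (k * a).
Proof. by move=> df; exact: is_deriveZ. Qed.

Lemma deriv_id x : is_derive x 1 (fun s : R => s) 1.
Proof. exact: is_derive_id. Qed.

Lemma deriv_sqr {f x a} : is_derive x 1 f a ->
  is_derive x 1 (fun s => f s ^+ 2) (2 * f x * a).
Proof.
move=> df; have dfn : is_derive x 1 (f ^+ 2) (2 * f x * a).
  by apply: is_derive_eq; rewrite expr1.
by rewrite exprfctE in dfn.
Qed.

Lemma deriv_pow {f x a} n : f x != 0 -> is_derive x 1 f a ->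
  is_derive x 1 (fun s => f s ^+ n) (n%:R * f x ^+ n / f x * a).
Proof.
move=> fx0 df.
have dfn : is_derive x 1 (f ^+ n) (n%:R * f x ^+ n / f x * a).
  apply: is_derive_eq; case: n => [|n]; first by rewrite !mul0r scale0r.
  by rewrite exprS; congr (_ * _) => /=; field.
by rewrite exprfctE in dfn.
Qed.

Lemma deriv_inv {f x a} : f x != 0 -> is_derive x 1 f a ->
  is_derive x 1 (fun s => (f s)^-1) (- a / f x ^+ 2).
Proof.
move=> fx0 df; apply: is_derive_eq (is_deriveV fx0 df) _.
by rewrite /GRing.scale /= mulrC mulrN mulNr.
Qed.

Lemma deriv_sqrt {f x a} : 0 < f x -> is_derive x 1 f a ->
  is_derive x 1 (fun s => Num.sqrt (f s)) (a / (2 * Num.sqrt (f x))).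
Proof.
move=> fx0 df; apply: is_derive_eq.
  exact: (@is_derive1_comp _ Num.sqrt f _ _ _ (is_derive1_sqrt fx0) df).
by rewrite mulrC.
Qed.

Lemma deriv_comp {f g x a b} : is_derive (g x) 1 f a -> is_derive x 1 g b ->
  is_derive x 1 (fun s => f (g s)) (a * b).
Proof. by move=> df dg; exact: (@is_derive1_comp _ f g). Qed.

Lemma deriv_continuous {f x a} : is_derive x 1 f a -> {for x, continuous f}.
Proof.
by move=> [df _]; exact/differentiable_continuous/derivable1_diffP.
Qed.

Lemma continuous_within_cc f c d :
  (forall x, c <= x <= d -> {for x, continuous f}) ->
  {within `[c, d], continuous f}.
Proof.
by move=> cf; apply: continuous_in_subspaceT => x; rewrite inE/= in_itv/= => /cf.
Qed.

(** The derivative is existentially quantified so that [eexists] lets the calculus rules compute it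
    before its sign is examined. *)
Lemma deriv_ge0_le g c d : c <= d ->
  (forall x, c <= x <= d -> {for x, continuous g}) ->
  (forall x, c < x < d -> exists2 l, is_derive x 1 g l & 0 <= l) ->
  g c <= g d.
Proof.
move=> cd cg dg.
have dg1 x : x \in `]c, d[%R -> derivable g x 1.
  by rewrite in_itv/= => /dg[l []].
apply: (ger0_derive1_le_cc dg1) => //; rewrite ?in_itv/= ?lexx ?cd//.
  move=> x; rewrite in_itv/= => /dg[l dl l0].
  by rewrite derive1E (@derive_val _ _ _ _ _ _ _ dl).
exact: continuous_within_cc.
Qed.

Lemma deriv_le0_ge g c d : c <= d ->
  (forall x, c <= x <= d -> {for x, continuous g}) ->
  (forall x, c < x < d -> exists2 l, is_derive x 1 g l & l <= 0) ->
  g d <= g c.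
Proof.
move=> cd cg dg; rewrite -lerN2.
apply: (deriv_ge0_le (fun s => - g s)); [exact: cd|move=> x xcd..].
  by apply: continuousN; exact: cg.
have [l dl l0] := dg x xcd.
by exists (- l); [exact: deriv_opp|rewrite oppr_ge0].
Qed.

Lemma continuous_gt0_near f x : {for x, continuous f} -> 0 < f x ->
  exists2 e, 0 < e & forall z, `|z - x| < e -> 0 < f z.
Proof.
move=> cf fx0; have /cf : nbhs (f x) [set z | 0 < z] by exact: lt_nbhsr.
rewrite /nbhs/= => -[e /= e0 he]; exists e => // z zx; apply: he => /=.
by rewrite distrC.
Qed.

(** Continuous induction: at the supremum of the points up to which [f] is positive, continuity
    gives [0 <= f], [step] excludes a first zero, and continuity then carries positivity past the
    supremum unless the end is reached. *)
Lemma barrier_up f c d : c <= d ->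
  (forall x, c <= x <= d -> {for x, continuous f}) -> 0 < f c ->
  (forall s, c < s <= d -> (forall x, c <= x < s -> 0 < f x) -> f s = 0 ->
    False) ->
  forall s, c <= s <= d -> 0 < f s.
Proof.
move=> cd cf fc0 step s0 /andP[cs0 s0d].
pose E := [set s | c <= s <= s0 /\ forall x, c <= x <= s -> 0 < f x].
have Ec : E c.
  by split=> [|x /le_anti <-//]; rewrite lexx.
have hs : has_sup E by split; [exists c|exists s0 => s [/andP[]]].
have cS : c <= sup E by apply: ub_le_sup => //; case: hs.
have Ss0 : sup E <= s0 by apply: ge_sup => [|s [/andP[]]//]; exists c.
have below x : c <= x < sup E -> 0 < f x.
  move=> /andP[cx xS].
  have [s [_ Es] xs] := @sup_adherent _ E (sup E - x) ltac:(by rewrite subr_gt0) hs.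
  by apply: Es; rewrite cx ltW//; move: xs; rewrite subKr.
have ge0 : 0 <= f (sup E).
  rewrite leNgt; apply/negP => fS.
  have [||e e0 he] := @continuous_gt0_near (fun z => - f z) (sup E) _ _.
    by apply: continuousN; apply: cf; rewrite cS (le_trans Ss0).
    by rewrite oppr_gt0.
  move: cS; rewrite le_eqVlt => /predU1P[cE|cS].
    by move: fS; rewrite -cE ltNge ltW.
  pose z := Num.max c (sup E - e / 2).
  have zS : z < sup E by rewrite /z gt_max cS /=; lra.
  have := he z; rewrite ltr_distl.
  have zl : sup E - e / 2 <= z by rewrite /z le_max lexx orbT.
  have -> : sup E - e < z < sup E + e by apply/andP; split; lra.
  move=> /(_ isT); rewrite oppr_gt0 ltNge ltW// below//.
  by rewrite zS andbT /z le_max lexx.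
have fS0 : 0 < f (sup E).
  rewrite lt_neqAle ge0 andbT; apply/eqP => fS.
  move: cS; rewrite le_eqVlt => /predU1P[cE|cS].
    by move: fc0; rewrite cE -fS ltxx.
  by apply: (step (sup E)) => //; rewrite cS (le_trans Ss0).
have belowS x : c <= x <= sup E -> 0 < f x.
  move=> /andP[cx]; rewrite le_eqVlt => /predU1P[->//|xS].
  by apply: below; rewrite cx.
have [sE|Sls0] := leP s0 (sup E); first by apply: belowS; rewrite cs0.
have [|e e0 he] := @continuous_gt0_near f (sup E) _ fS0.
  by apply: cf; rewrite cS (le_trans Ss0).
pose z := Num.min s0 (sup E + e / 2).
suff : z <= sup E by rewrite /z ge_min leNgt Sls0 /=; lra.
have zl : z <= sup E + e / 2 by rewrite /z ge_min lexx orbT.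
apply: ub_le_sup; first by case: hs.
split=> [|x /andP[cx xz]].
  by rewrite /z ge_min lexx /= le_min cs0 /=; lra.
have [xS|Sx] := leP x (sup E); first by apply: belowS; rewrite cx.
by apply: he; rewrite ltr_distl; apply/andP; split; lra.
Qed.

Lemma barrier_down f c d : c <= d ->
  (forall x, c <= x <= d -> {for x, continuous f}) -> 0 < f d ->
  (forall s, c <= s < d -> (forall x, s < x <= d -> 0 < f x) -> f s = 0 ->
    False) ->
  forall s, c <= s <= d -> 0 < f s.
Proof.
move=> cd cf fd0 step s scd.
rewrite -[s]opprK.
apply: (@barrier_up (fun z => f (- z)) (- d) (- c)).
- by rewrite lerN2.
- move=> x xdc; apply: (@continuous_comp _ _ _ -%R f x); first exact: opp_continuous.
  by apply: cf; move: xdc; lra.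
- by rewrite opprK.
- move=> z zdc hz; apply: step; first by move: zdc; lra.
  by move=> x xz; rewrite -[x]opprK; apply: hz; move: xz; lra.
- by move: scd; lra.
Qed.

End Calculus.

Section Continuity.
Context {R : realType}.
Implicit Types (f g : R -> R) (x a : R).

Lemma cont_add {f g x} : {for x, continuous f} -> {for x, continuous g} ->
  {for x, continuous (fun s => f s + g s)}.
Proof. by move=> cf cg; exact: continuousD. Qed.

Lemma cont_opp {f x} : {for x, continuous f} ->
  {for x, continuous (fun s => - f s)}.
Proof. by move=> cf; exact: continuousN. Qed.

Lemma cont_mul {f g x} : {for x, continuous f} -> {for x, continuous g} ->
  {for x, continuous (fun s => f s * g s)}.
Proof. by move=> cf cg; exact: continuousM. Qed.

Lemma cont_cst x a : {for x, continuous (fun=> a)}.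
Proof. exact: cst_continuous. Qed.

Lemma cont_id x : {for x, continuous (fun s : R => s)}.
Proof. by []. Qed.

Lemma cont_pow {f x} n : {for x, continuous f} ->
  {for x, continuous (fun s => f s ^+ n)}.
Proof.
move=> cf; elim: n => [|n IHn]; first exact: cont_cst.
rewrite (_ : (fun s => _) = fun s => f s * f s ^+ n); first exact: cont_mul.
by apply/funext => s; rewrite exprS.
Qed.

Lemma cont_inv {f x} : f x != 0 -> {for x, continuous f} ->
  {for x, continuous (fun s => (f s)^-1)}.
Proof. by move=> fx0 cf; exact: continuousV. Qed.

Lemma cont_comp {f g x} : {for x, continuous g} -> {for g x, continuous f} ->
  {for x, continuous (fun s => f (g s))}.
Proof. exact: continuous_comp. Qed.

Lemma cont_sqrt {f x} : {for x, continuous f} ->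
  {for x, continuous (fun s => Num.sqrt (f s))}.
Proof. by move=> cf; apply: cont_comp cf _; exact: sqrt_continuous. Qed.

End Continuity.

(** A quotient is looked up among the hypotheses first, because the continuity of [F t / f t] is
    supplied as a whole. *)
Ltac continuity := repeat lazymatch goal with
  | |- {for _, continuous (fun s => s)} => exact: cont_id
  | |- {for _, continuous (fun _ => ?c)} => exact: (@cont_cst _ _ c)
  | |- {for _, continuous (fun s => _ ^+ _)} => apply: cont_pow
  | |- {for _, continuous (fun s => _ + _)} => apply: cont_add
  | |- {for _, continuous (fun s => - _)} => apply: cont_opp
  | |- {for _, continuous (fun s => _ / _)} =>
      first [assumption | apply: cont_mul]
  | |- {for _, continuous (fun s => _ * _)} => apply: cont_mul
  | |- {for _, continuous (fun s => _^-1)} => apply: cont_inv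
  | |- {for _, continuous (fun s => Num.sqrt _)} => apply: cont_sqrt
  | |- {for _, continuous _} => assumption
  end.

(** * Monotone branches *)

(** [p] is the dimension minus 2, and [nl_K] is condition (3) multiplied by [2n]. [F] enters through
    these properties alone, so the comparison arguments never meet an integral. *)
Record nonlinearity (R : realType) (p : nat) (f F : R -> R) (B beta : R)
  : Prop := Nonlinearity {
  nl_B : 0 < B;
  nl_beta : B < beta;
  nl_F0 : F 0 = 0;
  nl_Fbeta : F beta = 0;
  nl_contF : forall s : R, 0 <= s -> {for s, continuous F};
  nl_derF : forall s : R, 0 < s -> is_derive s 1 F (f s);
  nl_contf : forall s : R, 0 < s -> {for s, continuous f};
  nl_fpos : forall s : R, B < s -> 0 < f s;
  nl_fneg : forall s : R, 0 <= s <= B -> f s <= 0;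
  nl_K : forall s : R, beta < s -> exists2 k : R,
    is_derive s 1 (fun t => F t / f t) k & p%:R <= 2 * p.+2%:R * k }.

Arguments nl_B {R p f F B beta}.
Arguments nl_beta {R p f F B beta}.
Arguments nl_F0 {R p f F B beta}.
Arguments nl_Fbeta {R p f F B beta}.
Arguments nl_contF {R p f F B beta} _ {s} _.
Arguments nl_derF {R p f F B beta} _ {s} _.
Arguments nl_contf {R p f F B beta} _ {s} _.
Arguments nl_fpos {R p f F B beta} _ {s} _.
Arguments nl_fneg {R p f F B beta} _ {s} _.
Arguments nl_K {R p f F B beta} _ {s} _.

(* A monotone piece of a solution u, described by its values: [r s] is the
   radius at which u equals [s], [y s] is |u'| there, and [sg] is the sign of
   u'. The dimension is n = p + 2. *)
Record branch (R : realType) (sg : R) (p : nat) (f F : R -> R) (M : R)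
    (r y : R -> R) : Prop := Branch {
  br_M : 0 < M;
  br_contr : forall s : R, 0 < s -> {for s, continuous r};
  br_conty : forall s : R, 0 < s -> {for s, continuous y};
  br_r : forall s : R, 0 < s <= M -> 0 < r s;
  br_y : forall s : R, 0 < s < M -> 0 < y s;
  br_yM : y M = 0;
  br_derr : forall s : R, 0 < s < M -> is_derive s 1 r (sg / y s);
  br_dery : forall s : R, 0 < s < M ->
    is_derive s 1 y (- sg * p.+1%:R / r s - f s / y s);
  br_energy : forall s : R, 0 < s <= M -> 0 < y s ^+ 2 + 2 * F s }.

Arguments br_M {R sg p f F M r y}.
Arguments br_contr {R sg p f F M r y} _ {s} _.
Arguments br_conty {R sg p f F M r y} _ {s} _.
Arguments br_r {R sg p f F M r y} _ {s} _.
Arguments br_y {R sg p f F M r y} _ {s} _.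
Arguments br_yM {R sg p f F M r y}.
Arguments br_derr {R sg p f F M r y} _ {s} _.
Arguments br_dery {R sg p f F M r y} _ {s} _.
Arguments br_energy {R sg p f F M r y} _ {s} _.

Definition flux {R : realType} (p : nat) (r y : R -> R) (s : R) : R :=
  r s ^+ p.+1 * y s.

(* The derivative of this functional is [flux] times [serrin_rate], whose sign
   is condition (3). *)
Definition serrin {R : realType} (sg : R) (p : nat) (f F r y : R -> R) (s : R)
    : R :=
  r s ^+ p.+2 * (y s ^+ 2 + 2 * F s) +
  sg * (2 * p.+2%:R) * (F s / f s * flux p r y s).

Definition serrin_rate {R : realType} (p : nat) (f F : R -> R) (s : R) : R :=
  2 * p.+2%:R * 'D_1 (fun t => F t / f t) s - p%:R.

(** * Monotonicity formulas along a single branch *)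

Section Nonlinearity.
Context {R : realType} {p : nat} {f F : R -> R} {B beta : R}.
Hypothesis NL : nonlinearity R p f F B beta.

Lemma nl_beta_gt0 : 0 < beta.
Proof. exact: lt_trans (nl_B NL) (nl_beta NL). Qed.

(** [F] decreases from [F 0 = 0] on [[0, B]] and then increases to [F beta = 0]. *)
Lemma nl_Fle0 {s} : 0 <= s <= beta -> F s <= 0.
Proof.
have B0 := nl_B NL; have Bb := nl_beta NL.
move=> /andP[s0 sb]; have [sB|Bs] := leP s B.
  rewrite -(nl_F0 NL); apply: deriv_le0_ge => // x xs.
    by apply: (nl_contF NL); move: xs; lra.
  exists (f x); first by apply: (nl_derF NL); move: xs; lra.
  by apply: (nl_fneg NL); move: xs; lra.
rewrite -(nl_Fbeta NL); apply: deriv_ge0_le => // x xs.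
  by apply: (nl_contF NL); move: xs; lra.
exists (f x); first by apply: (nl_derF NL); move: xs; lra.
by apply/ltW/(nl_fpos NL); move: xs; lra.
Qed.

Lemma nl_contG {s} : beta <= s -> {for s, continuous (fun t => F t / f t)}.
Proof.
move=> bs; have B0 := nl_B NL; have Bb := nl_beta NL.
have cF : {for s, continuous F} by apply: (nl_contF NL); lra.
have cf : {for s, continuous f} by apply: (nl_contf NL); lra.
have f0 : f s != 0 by apply/lt0r_neq0/(nl_fpos NL); lra.
by continuity.
Qed.

Lemma serrin_rate_ge0 {s} : beta < s -> 0 <= serrin_rate p f F s.
Proof.
move=> bs; have [k dG pk] := nl_K NL bs.
by rewrite /serrin_rate (@derive_val _ _ _ _ _ _ _ dG) subr_ge0.
Qed.

Section Branch.
Context {sg M : R} {r y : R -> R}.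
Hypothesis br : branch R sg p f F M r y.

(** At the maximum the speed vanishes, so the positive energy there is [2 * F M], while [F <= 0] up
    to [beta]. *)
Lemma beta_lt_max : beta < M.
Proof.
have M0 := br_M br; rewrite ltNge; apply/negP => Mb.
have := @br_energy _ _ _ _ _ _ _ _ br M; rewrite M0 lexx => /(_ isT).
rewrite (br_yM br) expr0n/= add0r ltNge => /negP; apply.
by rewrite pmulr_rle0// nl_Fle0// (ltW M0).
Qed.

Lemma br_y_ge0 {s} : 0 < s <= M -> 0 <= y s.
Proof.
move=> /andP[s0]; rewrite le_eqVlt => /predU1P[->|sM].
  by rewrite (br_yM br).
by apply/ltW/(br_y br); rewrite s0.
Qed.

Let contr {s : R} : 0 < s -> {for s, continuous r}. Proof. exact: (br_contr br). Qed.
Let conty {s : R} : 0 < s -> {for s, continuous y}. Proof. exact: (br_conty br). Qed.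
Let contF {s : R} : 0 < s -> {for s, continuous F}.
Proof. by move=> /ltW; exact: (nl_contF NL). Qed.

Lemma deriv_energy {s} : 0 < s < M ->
  is_derive s 1 (fun t => y t ^+ 2 + 2 * F t)
    (- 2 * sg * p.+1%:R * y s / r s).
Proof.
move=> sM; have r0 : 0 < r s by apply: (br_r br); move: sM; lra.
have y0 := br_y br sM.
have dF : is_derive s 1 F (f s) by apply: (nl_derF NL); move: sM; lra.
apply: is_derive_eq (deriv_add (deriv_sqr (br_dery br sM)) (deriv_scale 2 dF)) _.
by field; rewrite !gt_eqF.
Qed.

Lemma deriv_radius_pow n {s} : 0 < s < M ->
  is_derive s 1 (fun t => r t ^+ n) (n%:R * r s ^+ n / r s * (sg / y s)).
Proof.
move=> sM; have r0 : 0 < r s by apply: (br_r br); move: sM; lra.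
by apply: deriv_pow (br_derr br sM); rewrite gt_eqF.
Qed.

(** This is the divergence form [(r^(n-1) u')' = - r^(n-1) f(u)] with the value as variable; the two
    terms containing [sg] cancel. *)
Lemma deriv_flux {s} : 0 < s < M ->
  is_derive s 1 (flux p r y) (- r s ^+ p.+1 * f s / y s).
Proof.
move=> sM; have r0 : 0 < r s by apply: (br_r br); move: sM; lra.
have y0 := br_y br sM.
apply: is_derive_eq (deriv_mul (deriv_radius_pow p.+1 sM) (br_dery br sM)) _.
by field; rewrite !gt_eqF.
Qed.

Lemma cont_flux {s} : 0 < s -> {for s, continuous (flux p r y)}.
Proof. by move=> s0; have := contr s0; have := conty s0; rewrite /flux => ? ?; continuity. Qed.

(** A Pohozaev-type identity: the second summand of [serrin] is chosen so that the undifferentiated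
    terms in [F] cancel and only the derivative of [F / f] remains. *)
Lemma deriv_serrin {s} : beta < s < M ->
  is_derive s 1 (serrin sg p f F r y) (sg * serrin_rate p f F s * flux p r y s).
Proof.
move=> /andP[bs sM]; have s0 : 0 < s by apply: lt_trans bs; exact: nl_beta_gt0.
have s0M : 0 < s < M by rewrite s0.
have r0 : 0 < r s by apply: (br_r br); rewrite s0 ltW.
have y0 := br_y br s0M.
have f0 : 0 < f s by apply: (nl_fpos NL); exact: lt_trans (nl_beta NL) bs.
have [k dG pk] := nl_K NL bs.
have -> : serrin_rate p f F s = 2 * p.+2%:R * k - p%:R.
  by rewrite /serrin_rate (@derive_val _ _ _ _ _ _ _ dG).
apply: is_derive_eq (deriv_add (deriv_mul (deriv_radius_pow p.+2 s0M)
  (deriv_energy s0M)) (deriv_scale _ (deriv_mul dG (deriv_flux s0M)))) _.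
rewrite /flux [r s ^+ p.+2]exprS -!natr1.
by field; rewrite !gt_eqF.
Qed.

Lemma cont_serrin {s} : beta <= s -> {for s, continuous (serrin sg p f F r y)}.
Proof.
move=> bs; have s0 : 0 < s by apply: lt_le_trans bs; exact: nl_beta_gt0.
have := nl_contG bs; have := contr s0; have := conty s0; have := contF s0.
have := cont_flux s0; rewrite /serrin => ? ? ? ? ?.
by continuity.
Qed.

(** The weight [r^(2n-2)] cancels the terms in [y^2], so the sign of the derivative is that of
    [sg * F]. *)
Lemma deriv_scaled_energy {s} : 0 < s < M ->
  is_derive s 1 (fun t => (r t ^+ p.+1) ^+ 2 * (y t ^+ 2 + 2 * F t))
    (sg * (4 * p.+1%:R) * F s * (r s * (r s ^+ p) ^+ 2 / y s)).
Proof.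
move=> sM; have r0 : 0 < r s by apply: (br_r br); move: sM; lra.
have y0 := br_y br sM.
apply: is_derive_eq (deriv_mul (deriv_sqr (deriv_radius_pow p.+1 sM))
  (deriv_energy sM)) _.
by rewrite exprS; field; rewrite !gt_eqF.
Qed.

End Branch.
End Nonlinearity.

Lemma pow_le {R : realType} {a b : R} n : 0 < a -> a <= b -> a ^+ n <= b ^+ n.
Proof. by move=> a0 ab; apply: lerXn2r => //; rewrite nnegrE; lra. Qed.

(** * Comparison of rising branches *)

Section RisingBranches.
Context {R : realType} {p : nat} {f F : R -> R} {B beta : R}.
Hypothesis NL : nonlinearity R p f F B beta.
Context {M1 M2 : R} {r1 y1 r2 y2 : R -> R}.
Hypothesis br1 : branch R 1 p f F M1 r1 y1.
Hypothesis br2 : branch R 1 p f F M2 r2 y2.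
Hypothesis contr1 : forall {s : R}, 0 <= s -> {for s, continuous r1}.
Hypothesis contr2 : forall {s : R}, 0 <= s -> {for s, continuous r2}.
Hypothesis conty1 : forall {s : R}, 0 <= s -> {for s, continuous y1}.
Hypothesis conty2 : forall {s : R}, 0 <= s -> {for s, continuous y2}.
Hypothesis r12 : r1 0 = r2 0.
Hypothesis r10 : 0 < r1 0.
Hypothesis y10 : 0 < y1 0.
Hypothesis y12 : y1 0 < y2 0.

Let bounds : [/\ 0 < B, B < beta, beta < M1 & beta < M2].
Proof.
by split; [exact: (nl_B NL)|exact: (nl_beta NL)|exact: (beta_lt_max NL br1)
  |exact: (beta_lt_max NL br2)].
Qed.

(** Radius is gained at the rate [1 / y] per unit of value, so the slower branch is further out. *)
Let radius_ge {s : R} : s <= M1 -> s <= M2 ->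
  (forall x, 0 <= x < s -> 0 < y2 x - y1 x) ->
  forall x, 0 <= x <= s -> r2 x <= r1 x.
Proof.
have [B0 Bbeta betaM1 betaM2] := bounds.
have beta0 : 0 < beta by lra.
have M10 : 0 < M1 by lra.
have M20 : 0 < M2 by lra.
move=> sM1 sM2 y21 x /andP[x0 xs].
suff : r1 0 - r2 0 <= r1 x - r2 x by rewrite r12; lra.
apply: (@deriv_ge0_le _ (fun t => r1 t - r2 t)) => // t tx.
  have t0 : 0 <= t by move: tx; lra.
  by have := contr1 t0; have := contr2 t0 => ? ?; continuity.
have t1 : 0 < t < M1 by move: tx; lra.
have t2 : 0 < t < M2 by move: tx; lra.
eexists; first exact: deriv_sub (br_derr br1 t1) (br_derr br2 t2).
have yt1 := br_y br1 t1; have yt2 := br_y br2 t2.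
rewrite !mul1r subr_ge0 lef_pV2 ?posrE// ltW// -subr_gt0.
by apply: y21; move: tx; lra.
Qed.

Let J (r y : R -> R) t := (r t ^+ p.+1) ^+ 2 * (y t ^+ 2 + 2 * F t).

(** The rates of [J] differ by a multiple of [F] times the difference of [r^(2n-3) / y]. That
    quotient is larger on the slower branch, and [F <= 0] below [beta], so the initial order of [J]
    is preserved. *)
Let scaled_energy_lt {s : R} : 0 <= s <= beta ->
  (forall x, 0 <= x < s -> 0 < y2 x - y1 x) -> J r1 y1 s < J r2 y2 s.
Proof.
have [B0 Bbeta betaM1 betaM2] := bounds.
have beta0 : 0 < beta by lra.
have M10 : 0 < M1 by lra.
have M20 : 0 < M2 by lra.
move=> /andP[s0 sb] y21.
have sM1 : s <= M1 by lra. have sM2 : s <= M2 by lra.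
have rge := radius_ge sM1 sM2 y21.
suff le : J r1 y1 s - J r2 y2 s <= J r1 y1 0 - J r2 y2 0.
  rewrite -subr_lt0; apply: le_lt_trans le _.
  rewrite /J r12 (nl_F0 NL) !mulr0 !addr0 -mulrBr pmulr_rlt0; last first.
    by rewrite !exprn_gt0// -r12.
  by rewrite subr_lt0 ltr_pXn2r// ?nnegrE ?(ltW y10)// ltW// (lt_trans y10).
apply: (@deriv_le0_ge _ (fun t => J r1 y1 t - J r2 y2 t)) => // t ts.
  have t0 : 0 <= t by move: ts; lra.
  have := contr1 t0; have := contr2 t0; have := conty1 t0; have := conty2 t0.
  by have := nl_contF NL t0 => ? ? ? ? ?; rewrite /J; continuity.
have t1 : 0 < t < M1 by move: ts; lra.
have t2 : 0 < t < M2 by move: ts; lra.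
eexists.
  exact: deriv_sub (deriv_scaled_energy NL br1 t1) (deriv_scaled_energy NL br2 t2).
have yt1 := br_y br1 t1; have yt2 := br_y br2 t2.
have Ft : F t <= 0 by apply: (nl_Fle0 NL); move: ts; lra.
have rt : r2 t <= r1 t by apply: rge; move: ts; lra.
have rt2 : 0 < r2 t by apply: (br_r br2); move: t2; lra.
have rt1 : 0 < r1 t by lra.
have yt : y1 t < y2 t by rewrite -subr_gt0; apply: y21; move: ts; lra.
rewrite -mulrBr mulr_le0_ge0//.
  by rewrite mul1r mulr_ge0_le0.
rewrite subr_ge0 ler_pM// ?invr_ge0 ?mulr_ge0 ?exprn_ge0 ?(ltW rt2) ?(ltW yt2)//.
  rewrite ler_pM// ?exprn_ge0 ?(ltW rt2)//.
  by rewrite -!exprM; exact: pow_le.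
by rewrite lef_pV2 ?posrE// ltW.
Qed.

(** At [beta] the term in [F] vanishes and [J] is the square of the flux. *)
Let flux_lt_beta : (forall x, 0 <= x < beta -> 0 < y2 x - y1 x) ->
  flux p r1 y1 beta < flux p r2 y2 beta.
Proof.
have [B0 Bbeta betaM1 betaM2] := bounds.
have beta0 : 0 < beta by lra.
have M10 : 0 < M1 by lra.
have M20 : 0 < M2 by lra.
move=> y21; have := @scaled_energy_lt beta.
rewrite (ltW beta0) lexx => /(_ isT y21).
rewrite /J (nl_Fbeta NL) !mulr0 !addr0 -!exprMn /flux.
have b1 : 0 < beta < M1 by rewrite beta0.
have b2 : 0 < beta < M2 by rewrite beta0.
have := br_y br1 b1; have := br_y br2 b2 => ? ?.
have ? : 0 < r1 beta by apply: (br_r br1); lra.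
have ? : 0 < r2 beta by apply: (br_r br2); lra.
by rewrite ltr_pXn2r// nnegrE mulr_ge0 ?exprn_ge0 ?ltW.
Qed.

(** Above [beta] the flux is lost at the rate [r^(n-1) f / y], which is larger on the slower
    branch. *)
Let flux_lt {s : R} : beta <= s -> s <= M1 -> s <= M2 ->
  (forall x, 0 <= x < s -> 0 < y2 x - y1 x) ->
  flux p r1 y1 s < flux p r2 y2 s.
Proof.
have [B0 Bbeta betaM1 betaM2] := bounds.
have beta0 : 0 < beta by lra.
have M10 : 0 < M1 by lra.
have M20 : 0 < M2 by lra.
move=> bs sM1 sM2 y21.
have rge := radius_ge sM1 sM2 y21.
have fb : flux p r1 y1 beta < flux p r2 y2 beta.
  by apply: flux_lt_beta => x xb; apply: y21; move: xb; lra.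
rewrite -subr_gt0; apply: lt_le_trans (_ : flux p r2 y2 beta - flux p r1 y1 beta <= _).
  by rewrite subr_gt0.
apply: (@deriv_ge0_le _ (fun t => flux p r2 y2 t - flux p r1 y1 t)) => // t ts.
  have t0 : 0 < t by move: ts; lra.
  by have := cont_flux br1 t0; have := cont_flux br2 t0 => ? ?; continuity.
have t1 : 0 < t < M1 by move: ts; lra.
have t2 : 0 < t < M2 by move: ts; lra.
eexists; first exact: deriv_sub (deriv_flux br2 t2) (deriv_flux br1 t1).
have yt1 := br_y br1 t1; have yt2 := br_y br2 t2.
have ft : 0 < f t by apply: (nl_fpos NL); move: ts; lra.
have rt : r2 t <= r1 t by apply: rge; move: ts; lra.
have rt2 : 0 < r2 t by apply: (br_r br2); move: t2; lra.
have rt1 : 0 < r1 t by lra.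
have yt : y1 t < y2 t by rewrite -subr_gt0; apply: y21; move: ts; lra.
rewrite !mulNr opprK addrC subr_ge0 ler_pM//.
- by rewrite mulr_ge0 ?exprn_ge0 ?ltW.
- by rewrite invr_ge0 ltW.
- by rewrite ler_pM2r// ler_pXn2r// nnegrE ltW.
- by rewrite lef_pV2 ?posrE// ltW.
Qed.

(** At a first value with equal speeds the first branch has the larger radius, hence at least as
    large a [J] and flux; this contradicts [scaled_energy_lt] below [beta] and [flux_lt] above. *)
Lemma rising_speed_lt {s} : 0 <= s -> s <= M1 -> s <= M2 -> y1 s < y2 s.
Proof.
have [B0 Bbeta betaM1 betaM2] := bounds.
have beta0 : 0 < beta by lra.
have M10 : 0 < M1 by lra.
have M20 : 0 < M2 by lra.
move=> s0 sM1 sM2.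
rewrite -subr_gt0; apply: (@barrier_up _ (fun x => y2 x - y1 x) 0 s) => //.
- move=> x /andP[x0 _].
  by have := conty1 x0; have := conty2 x0 => ? ?; continuity.
- by rewrite subr_gt0.
- move=> t /andP[t0 ts] y21 /eqP; rewrite subr_eq0 => /eqP yt.
  have tM1 : t <= M1 by lra. have tM2 : t <= M2 by lra.
  have rt : r2 t <= r1 t.
    by apply: (radius_ge tM1 tM2 y21); rewrite (ltW t0) lexx.
  have rt2 : 0 < r2 t by apply: (br_r br2); rewrite t0.
  have rp : r2 t ^+ p.+1 <= r1 t ^+ p.+1 by exact: pow_le.
  have r2p : 0 < r2 t ^+ p.+1 by rewrite exprn_gt0.
  have [tb|bt] := leP t beta.
    have := @scaled_energy_lt t; rewrite (ltW t0) tb => /(_ isT y21).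
    rewrite /J yt ltNge ler_pM2r; last by apply: (br_energy br1); rewrite t0.
    by rewrite (pow_le 2 r2p rp).
  have := flux_lt (ltW bt) tM1 tM2 y21; rewrite /flux yt ltNge.
  by rewrite ler_wpM2r// (br_y_ge0 br1)// t0.
- by rewrite s0 lexx.
Qed.

Lemma rising_max_lt : M1 < M2.
Proof.
have [B0 Bbeta betaM1 betaM2] := bounds.
have beta0 : 0 < beta by lra.
have M10 : 0 < M1 by lra.
have M20 : 0 < M2 by lra.
rewrite ltNge; apply/negP => M21.
have := @rising_speed_lt M2 (ltW M20) M21 (lexx _).
by rewrite (br_yM br2) ltNge (br_y_ge0 br1)// M20.
Qed.

Lemma rising_radius_ge {s} : 0 <= s <= M1 -> r2 s <= r1 s.
Proof.
have [B0 Bbeta betaM1 betaM2] := bounds.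
have beta0 : 0 < beta by lra.
have M10 : 0 < M1 by lra.
have M20 : 0 < M2 by lra.
move=> sM1; have M12 := rising_max_lt.
apply: (@radius_ge M1) => //; first by rewrite ltW.
by move=> x xM; rewrite subr_gt0; apply: rising_speed_lt; move: xM; lra.
Qed.

Lemma rising_flux_lt {s} : beta <= s <= M1 -> flux p r1 y1 s < flux p r2 y2 s.
Proof.
have [B0 Bbeta betaM1 betaM2] := bounds.
have beta0 : 0 < beta by lra.
have M10 : 0 < M1 by lra.
have M20 : 0 < M2 by lra.
move=> sM1; have M12 := rising_max_lt.
apply: flux_lt; [move: sM1; lra..|].
by move=> x xM; rewrite subr_gt0; apply: rising_speed_lt; move: sM1 xM; lra.
Qed.

(** At [beta] the functional is [r^n y^2], the product of the flux and [r y], and both factors are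
    ordered. Above [beta] the gap grows at the rate [serrin_rate] times the difference of the
    fluxes. *)
Lemma rising_serrin_lt {s} : beta <= s <= M1 ->
  serrin 1 p f F r1 y1 s < serrin 1 p f F r2 y2 s.
Proof.
have [B0 Bbeta betaM1 betaM2] := bounds.
have beta0 : 0 < beta by lra.
have M10 : 0 < M1 by lra.
have M20 : 0 < M2 by lra.
move=> sM; have M12 := rising_max_lt.
rewrite -subr_gt0.
apply: lt_le_trans (_ : serrin 1 p f F r2 y2 beta - serrin 1 p f F r1 y1 beta <= _).
  have bM : beta <= beta <= M1 by rewrite lexx ltW.
  have yb : y1 beta < y2 beta by apply: rising_speed_lt; lra.
  have rb : r2 beta <= r1 beta by apply: rising_radius_ge; lra.
  have r2b : 0 < r2 beta by apply: (br_r br2); lra.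
  have y1b : 0 < y1 beta by apply: (br_y br1); lra.
  rewrite /serrin (nl_Fbeta NL) !(mul0r, mulr0, addr0) subr_gt0.
  have := rising_flux_lt bM; rewrite /flux => fl.
  (* The flux inequality is divided by [r2 beta ^+ p], using [r2 beta <= r1 beta]. *)
  have ry : r1 beta * y1 beta < r2 beta * y2 beta.
    rewrite -(@ltr_pM2l _ (r2 beta ^+ p)) ?exprn_gt0//.
    apply: le_lt_trans (_ : r1 beta ^+ p * (r1 beta * y1 beta) < _).
      by rewrite ler_wpM2r ?mulr_ge0 ?pow_le//; lra.
    by rewrite !mulrA -!exprSr.
  have E (r y : R) : r ^+ p.+2 * y ^+ 2 = (r ^+ p.+1 * y) * (r * y).
    by rewrite exprS; ring.
  by rewrite !E ltr_pM// ?mulr_ge0 ?exprn_ge0//; lra.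
apply: (@deriv_ge0_le _ (fun t => serrin 1 p f F r2 y2 t - serrin 1 p f F r1 y1 t)).
- by move: sM => /andP[].
- move=> t ts; have t0 : beta <= t by move: ts; lra.
  by have := cont_serrin NL br1 t0; have := cont_serrin NL br2 t0 => ? ?; continuity.
move=> t ts.
have t1 : beta < t < M1 by move: ts sM; lra.
have t2 : beta < t < M2 by move: ts sM; lra.
eexists; first exact: deriv_sub (deriv_serrin NL br2 t2) (deriv_serrin NL br1 t1).
rewrite !mul1r -mulrBr; apply: mulr_ge0.
  by apply: (serrin_rate_ge0 NL); move: ts; lra.
by rewrite subr_ge0 ltW// rising_flux_lt//; move: ts sM; lra.
Qed.

End RisingBranches.

Lemma pow_lt {R : realType} {a b : R} n : 0 < a -> a < b -> a ^+ n.+1 < b ^+ n.+1.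
Proof. by move=> a0 ab; rewrite ltr_pXn2r// nnegrE; lra. Qed.

(** * Comparison of falling branches *)

(* The derivative in s of r sqrt (y^2 + 2 F), with c = - 2 F and z the square
   root, compared at two speeds. *)
Lemma scaled_speed_le {R : realType} (p : nat) (c y1 y2 z1 z2 : R) : 0 <= c ->
  0 < y1 -> y1 < y2 -> 0 < z1 -> 0 < z2 ->
  z1 ^+ 2 = y1 ^+ 2 - c -> z2 ^+ 2 = y2 ^+ 2 - c ->
  (p%:R * y2 ^+ 2 + c) / (y2 * z2) <= (p%:R * y1 ^+ 2 + c) / (y1 * z1).
Proof.
move=> c0 y10 y12 z10 z20 e1 e2.
have y20 : 0 < y2 by lra.
have z12 : z1 < z2.
  by rewrite -(@ltr_pXn2r _ 2) ?nnegrE ?ltW// e1 e2 ltrD2r; exact: pow_lt.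
(* Both summands decrease with the speed: [c / (y * z)] because [y] and [z] increase, and [y / z]
   because [z^2 = y^2 - c] with [c >= 0]. *)
have -> : (p%:R * y2 ^+ 2 + c) / (y2 * z2) = p%:R * (y2 / z2) + c / (y2 * z2).
  by field; rewrite !gt_eqF.
have -> : (p%:R * y1 ^+ 2 + c) / (y1 * z1) = p%:R * (y1 / z1) + c / (y1 * z1).
  by field; rewrite !gt_eqF.
apply: lerD; last first.
  apply: ler_wpM2l => //; rewrite lef_pV2 ?posrE ?mulr_gt0//.
  by rewrite ler_pM// ltW.
apply: ler_wpM2l; first exact: ler0n.
rewrite ler_pdivrMr// mulrAC ler_pdivlMr//.
rewrite -(@ler_pXn2r _ 2)//; [|by rewrite nnegrE mulr_ge0// ltW..].
rewrite !exprMn e1 e2.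
rewrite -subr_ge0 (_ : _ - _ = c * (y2 ^+ 2 - y1 ^+ 2)); last by ring.
by apply: mulr_ge0 => //; have := pow_lt 1 y10 y12; lra.
Qed.

Section FallingBranches.
Context {R : realType} {p : nat} {f F : R -> R} {B beta : R}.
Hypothesis NL : nonlinearity R p f F B beta.
Context {M1 M2 : R} {r1 y1 r2 y2 : R -> R}.
Hypothesis br1 : branch R (-1) p f F M1 r1 y1.
Hypothesis br2 : branch R (-1) p f F M2 r2 y2.
Hypothesis lt_M12 : M1 < M2.
(** This expresses [liminf r y = 0] at small values; [1 <= r2 s] makes [y2 s] itself small as
    well. *)
Hypothesis tail : forall {c e : R}, 0 < c -> 0 < e ->
  exists s : R, [/\ 0 < s, s < c, 1 <= r2 s & r2 s * y2 s < e].

Let bounds : [/\ 0 < B, B < beta, beta < M1 & M1 < M2].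
Proof.
by split; [exact: (nl_B NL)|exact: (nl_beta NL)|exact: (beta_lt_max NL br1)|].
Qed.

(** Read downwards, a falling branch gains radius at the rate [1 / y], so the slower one stays
    further out. *)
Let radius_ge {s s0 : R} : 0 < s -> s <= s0 -> s0 <= M1 -> r2 s0 <= r1 s0 ->
  (forall x, s < x <= s0 -> 0 < y2 x - y1 x) -> r2 s <= r1 s.
Proof.
have [B0 Bbeta betaM1 M12] := bounds.
move=> s_gt0 ss0 s0M1 r21 y21.
suff : r1 s0 - r2 s0 <= r1 s - r2 s by lra.
apply: (@deriv_le0_ge _ (fun t => r1 t - r2 t)) => // t ts.
  have t0 : 0 < t by move: ts; lra.
  by have := br_contr br1 t0; have := br_contr br2 t0 => ? ?; continuity.
have t1 : 0 < t < M1 by move: ts; lra.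
have t2 : 0 < t < M2 by move: ts; lra.
eexists; first exact: deriv_sub (br_derr br1 t1) (br_derr br2 t2).
have yt1 := br_y br1 t1; have yt2 := br_y br2 t2.
rewrite !mulN1r opprK addrC subr_le0 lef_pV2 ?posrE// ltW// -subr_gt0.
by apply: y21; move: ts; lra.
Qed.

(** This is [(y2^2 - y1^2)^2 (r1 r2)^(n-1)], written through the energies because their derivatives
    contain no [f]. *)
Let Theta t := ((y2 t ^+ 2 + 2 * F t) - (y1 t ^+ 2 + 2 * F t)) ^+ 2 *
  (r1 t ^+ p.+1 * r2 t ^+ p.+1).

(** Once factored, the derivative has the sign opposite to [d (r2 y2 + r1 y1) - 4 y1 y2 (r1 y2 - r2
    y1)] with [d = y2^2 - y1^2], and this is nonnegative when [r1 <= r2] and [y1 < y2]. *)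
Let Theta_ge {s : R} : 0 < s -> s <= M1 ->
  (forall x, s <= x <= M1 -> r1 x <= r2 x) ->
  (forall x, s < x <= M1 -> 0 < y2 x - y1 x) -> Theta M1 <= Theta s.
Proof.
have [B0 Bbeta betaM1 M12] := bounds.
move=> s_gt0 sM1 r12 y21.
apply: deriv_le0_ge => // t ts.
  have t0 : 0 < t by move: ts; lra.
  have := br_contr br1 t0; have := br_contr br2 t0.
  have := br_conty br1 t0; have := br_conty br2 t0.
  by have := nl_contF NL (ltW t0) => ? ? ? ? ?; rewrite /Theta; continuity.
have t1 : 0 < t < M1 by move: ts; lra.
have t2 : 0 < t < M2 by move: ts; lra.
eexists.
  exact: deriv_mul (deriv_sqr (deriv_sub (deriv_energy NL br2 t2)
   (deriv_energy NL br1 t1)))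
   (deriv_mul (deriv_radius_pow br1 p.+1 t1) (deriv_radius_pow br2 p.+1 t2)).
have yt1 := br_y br1 t1; have yt2 := br_y br2 t2.
have rt1 : 0 < r1 t by apply: (br_r br1); lra.
have rt2 : 0 < r2 t by apply: (br_r br2); lra.
have rt : r1 t <= r2 t by apply: r12; lra.
have yt : y1 t < y2 t by rewrite -subr_gt0; apply: y21; lra.
set A1 := r1 t ^+ p.+1; set A2 := r2 t ^+ p.+1.
have A10 : 0 < A1 by rewrite exprn_gt0.
have A20 : 0 < A2 by rewrite exprn_gt0.
pose d := y2 t ^+ 2 - y1 t ^+ 2.
have d0 : 0 < d by have := pow_lt 1 yt1 yt; rewrite /d; lra.
rewrite (_ : _ + _ = - (A1 * A2 * d * p.+1%:R / (r1 t * r2 t * y1 t * y2 t)) *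
   (d * (r2 t * y2 t + r1 t * y1 t) -
     4 * y1 t * y2 t * (r1 t * y2 t - r2 t * y1 t))); last first.
  by rewrite /d -natr1; field; rewrite !gt_eqF.
rewrite mulNr oppr_le0 mulr_ge0//.
  by rewrite ltW// divr_gt0 ?mulr_gt0.
(* AM-GM: the left-hand side is increasing in r2, and at r2 = r1 it is
   (y2 - y1) r1 ((y1 + y2)^2 - 4 y1 y2). *)
rewrite (_ : _ - _ = (r2 t - r1 t) * (d * y2 t + 4 * y1 t ^+ 2 * y2 t) +
   r1 t * (y2 t - y1 t) ^+ 3); last by rewrite /d; ring.
apply: addr_ge0; apply: mulr_ge0.
- by rewrite subr_ge0.
- by rewrite addr_ge0// !mulr_ge0 ?exprn_ge0 ?ltW.
- exact: ltW.
- by rewrite exprn_ge0// subr_ge0 ltW.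
Qed.

Let y2M1 : 0 < y2 M1.
Proof. by have [B0 Bbeta betaM1 M12] := bounds; apply: (br_y br2); lra. Qed.

Let Theta_M1 : 0 < Theta M1.
Proof.
have [B0 Bbeta betaM1 M12] := bounds.
have r1M : 0 < r1 M1 by apply: (br_r br1); lra.
have r2M : 0 < r2 M1 by apply: (br_r br2); lra.
rewrite /Theta (br_yM br1) mulr_gt0//; last by rewrite mulr_gt0// exprn_gt0.
by rewrite exprn_gt0//; have := exprn_gt0 2 y2M1; rewrite expr0n/=; lra.
Qed.

Lemma falling_speed_lt {s : R} : 0 < s -> s <= M1 ->
  (forall x, s <= x <= M1 -> r1 x <= r2 x) -> y1 s < y2 s.
Proof.
have [B0 Bbeta betaM1 M12] := bounds.
move=> s_gt0 sM1 r12.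
rewrite -subr_gt0; apply: (@barrier_down _ (fun x => y2 x - y1 x) s M1) => //.
- move=> x /andP[sx _]; have x0 : 0 < x by lra.
  by have := br_conty br1 x0; have := br_conty br2 x0 => ? ?; continuity.
- by rewrite (br_yM br1) subr0.
- move=> t /andP[st tM] y21 /eqP; rewrite subr_eq0 => /eqP yt.
  have t0 : 0 < t by lra.
  have := Theta_ge t0 (ltW tM) _ y21.
  rewrite {2}/Theta yt subrr expr0n/= mul0r leNgt Theta_M1.
  by move=> /(_ _)/negP; apply=> // x xt; apply: r12; move: xt; lra.
- by rewrite lexx.
Qed.

(** If [r1 <= r2] persisted, [Theta] would stay above [Theta M1 > 0]. It is however at most the
    square of [flux * y2] for the second branch, whose flux is bounded below [B] and whose speed is
    arbitrarily small along [tail]. *)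
Lemma falling_radius_cross : ~ (forall x, 0 < x <= M1 -> r1 x <= r2 x).
Proof.
move=> r12; have [B0 Bbeta betaM1 M12] := bounds.
have yB : 0 < y2 B by apply: (br_y br2); lra.
have rB : 0 < r2 B by apply: (br_r br2); lra.
have C0 : 0 < flux p r2 y2 B by rewrite mulr_gt0// exprn_gt0.
set C := flux p r2 y2 B in C0.
(* The threshold makes [(C * y2 s) ^+ 2] smaller than [Theta M1]. *)
have e0 : 0 < Num.sqrt (Theta M1) / C by rewrite divr_gt0// sqrtr_gt0.
have [s [s0 sB r2s ry]] := tail B0 e0.
have s1 : 0 < s < M1 by lra. have s2 : 0 < s < M2 by lra.
have ys1 := br_y br1 s1; have ys2 := br_y br2 s2.
(* Since [f <= 0] on [[0, B]], the flux increases with the value there. *)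
have fl : flux p r2 y2 s <= C.
  apply: (@deriv_ge0_le _ (flux p r2 y2)); first exact: ltW.
    by move=> t ts; apply: (cont_flux br2); move: ts; lra.
  move=> t ts; have t2 : 0 < t < M2 by move: ts; lra.
  eexists; first exact (deriv_flux br2 t2).
  have ft : f t <= 0 by apply: (nl_fneg NL); move: ts; lra.
  rewrite mulNr -mulrN mulr_ge0 ?invr_ge0 ?mulr_ge0 ?oppr_ge0//.
    by rewrite exprn_ge0// ltW// (br_r br2)//; lra.
  by rewrite ltW// (br_y br2).
have y12 : y1 s < y2 s.
  by apply: falling_speed_lt => //; [lra|move=> x xs; apply: r12; lra].
have rs1 : 0 < r1 s by apply: (br_r br1); lra.
have rs12 : r1 s <= r2 s by apply: r12; lra.
suff : Theta s < Theta M1.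
  rewrite ltNge => /negP; apply; apply: Theta_ge; [lra..| |].
    by move=> x xs; apply: r12; lra.
  move=> x xs; rewrite subr_gt0; apply: falling_speed_lt; [lra..|].
  by move=> z zx; apply: r12; lra.
apply: (@le_lt_trans _ _ ((C * y2 s) ^+ 2)).
  apply: (@le_trans _ _ ((flux p r2 y2 s * y2 s) ^+ 2)); last first.
    have fl0 : 0 < flux p r2 y2 s by rewrite mulr_gt0// exprn_gt0//; lra.
    apply: lerXn2r; rewrite ?nnegrE ?ler_wpM2r//; last exact: ltW.
    - by rewrite mulr_ge0// ltW.
    - by rewrite mulr_ge0// ltW.
  have -> : (flux p r2 y2 s * y2 s) ^+ 2 =
      (y2 s ^+ 2) ^+ 2 * (r2 s ^+ p.+1 * r2 s ^+ p.+1) by rewrite /flux; ring.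
  have := pow_lt 1 ys1 y12 => ysq; have := exprn_gt0 2 ys1 => ysq1.
  have A1 : 0 < r1 s ^+ p.+1 by rewrite exprn_gt0.
  have A12 := pow_le p.+1 rs1 rs12.
  rewrite /Theta; apply: ler_pM.
  - exact: sqr_ge0.
  - by rewrite mulr_ge0; lra.
  - by apply: lerXn2r; rewrite ?nnegrE; lra.
  - by rewrite ler_wpM2r; lra.
rewrite -[ltRHS]sqr_sqrtr ?(ltW Theta_M1)//.
rewrite ltr_pXn2r//; [|by rewrite nnegrE mulr_ge0// ltW|exact: sqrtr_ge0].
rewrite mulrC -ltr_pdivlMr//.
by apply: le_lt_trans ry; rewrite ler_peMl// ltW.
Qed.

Let W (r y : R -> R) t := r t * Num.sqrt (y t ^+ 2 + 2 * F t).

Let deriv_W {M : R} {r y : R -> R} (br : branch R (-1) p f F M r y) {s : R} :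
  0 < s < M -> is_derive s 1 (W r y)
   ((p%:R * y s ^+ 2 + - (2 * F s)) / (y s * Num.sqrt (y s ^+ 2 + 2 * F s))).
Proof.
have [B0 Bbeta betaM1 M12] := bounds.
move=> sM; have E0 : 0 < y s ^+ 2 + 2 * F s by apply: (br_energy br); lra.
have y0 := br_y br sM; have r0 : 0 < r s by apply: (br_r br); lra.
apply: is_derive_eq (deriv_mul (br_derr br sM)
  (@deriv_sqrt _ (fun t => y t ^+ 2 + 2 * F t) _ _ E0 (deriv_energy NL br sM))) _.
have := sqr_sqrtr (ltW E0).
have : 0 < Num.sqrt (y s ^+ 2 + 2 * F s) by rewrite sqrtr_gt0.
set z := Num.sqrt _ => z0 zz.
have -> : 2 * F s = z ^+ 2 - y s ^+ 2 by rewrite zz; ring.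
by rewrite -natr1; field; rewrite !gt_eqF.
Qed.

(** By [scaled_speed_le] the gap between the two [W] grows downwards while [y1 < y2]. Equal speeds
    with [r2 <= r1] would make it nonpositive, so the order of speeds persists. But the gap is at
    most [r2 * y2], which [tail] makes smaller than the initial gap. *)
Lemma falling_tail {s0 : R} : 0 < s0 <= beta -> r2 s0 <= r1 s0 ->
  y1 s0 < y2 s0 ->
  r1 s0 * Num.sqrt (y1 s0 ^+ 2 + 2 * F s0) <
    r2 s0 * Num.sqrt (y2 s0 ^+ 2 + 2 * F s0) -> False.
Proof.
move=> /andP[s00 s0b] r21 y12 W12; have [B0 Bbeta betaM1 M12] := bounds.
have W_ge s : 0 < s -> s <= s0 -> (forall x, s < x <= s0 -> 0 < y2 x - y1 x) ->
    W r2 y2 s0 - W r1 y1 s0 <= W r2 y2 s - W r1 y1 s.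
  move=> s_gt0 ss0 y21.
  apply: (@deriv_le0_ge _ (fun t => W r2 y2 t - W r1 y1 t)) => // t ts.
    have t0 : 0 < t by move: ts; lra.
    have := br_contr br1 t0; have := br_contr br2 t0.
    have := br_conty br1 t0; have := br_conty br2 t0.
    by have := nl_contF NL (ltW t0) => ? ? ? ? ?; rewrite /W; continuity.
  have t1 : 0 < t < M1 by move: ts; lra.
  have t2 : 0 < t < M2 by move: ts; lra.
  eexists; first exact: deriv_sub (deriv_W br2 t2) (deriv_W br1 t1).
  have E1 : 0 < y1 t ^+ 2 + 2 * F t by apply: (br_energy br1); lra.
  have E2 : 0 < y2 t ^+ 2 + 2 * F t by apply: (br_energy br2); lra.
  rewrite subr_le0; apply: scaled_speed_le.
  - have : F t <= 0 by apply: (nl_Fle0 NL); lra.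
    by lra.
  - exact: (br_y br1 t1).
  - by rewrite -subr_gt0; apply: y21; lra.
  - by rewrite sqrtr_gt0.
  - by rewrite sqrtr_gt0.
  - by rewrite sqr_sqrtr ?ltW//; ring.
  - by rewrite sqr_sqrtr ?ltW//; ring.
have y21 s : 0 < s -> s <= s0 -> 0 < y2 s - y1 s.
  move=> s_gt0 ss0.
  apply: (@barrier_down _ (fun x => y2 x - y1 x) s s0) => //.
  - move=> x /andP[sx _]; have x0 : 0 < x by lra.
    by have := br_conty br1 x0; have := br_conty br2 x0 => ? ?; continuity.
  - by rewrite subr_gt0.
  - move=> t /andP[st ts0] y21 /eqP; rewrite subr_eq0 => /eqP yt.
    have t0 : 0 < t by lra.
    have s0M : s0 <= M1 by lra.
    have rt := radius_ge t0 (ltW ts0) s0M r21 y21.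
    have := W_ge t t0 (ltW ts0) y21; rewrite {3 4}/W yt leNgt => /negP; apply.
    apply: (@le_lt_trans _ _ 0); last by rewrite subr_gt0.
    by rewrite subr_le0 ler_wpM2r ?sqrtr_ge0.
  - by rewrite lexx.
have e0 : 0 < W r2 y2 s0 - W r1 y1 s0 by rewrite subr_gt0.
have [s [s_gt0 ss0 _ ry]] := tail s00 e0.
have := W_ge s s_gt0 (ltW ss0).
have W1 : 0 <= W r1 y1 s.
  by rewrite mulr_ge0 ?sqrtr_ge0// ltW// (br_r br1)//; lra.
have W2 : W r2 y2 s <= r2 s * y2 s.
  have ys : 0 < y2 s by apply: (br_y br2); lra.
  rewrite ler_wpM2l//; first by rewrite ltW// (br_r br2)//; lra.
  rewrite -[leRHS]gtr0_norm// -sqrtr_sqr ler_wsqrtr//.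
  have : F s <= 0 by apply: (nl_Fle0 NL); lra.
  by lra.
move=> /(_ _); rewrite leNgt => h.
suff : W r2 y2 s - W r1 y1 s < W r2 y2 s0 - W r1 y1 s0.
  by apply/negP/h => x xs; apply: y21; lra.
by lra.
Qed.

Let Q1 := serrin (-1) p f F r1 y1.
Let Q2 := serrin (-1) p f F r2 y2.
Let V1 := flux p r1 y1.
Let V2 := flux p r2 y2.

(** Read downwards, [Q2 - Q1] changes at the rate [serrin_rate * (V2 - V1)], nonnegative by
    condition (3). *)
Let serrin_gap {s s0 : R} : beta <= s -> s <= s0 -> s0 <= M1 ->
  (forall x, s <= x <= s0 -> V1 x <= V2 x) -> Q2 s0 - Q1 s0 <= Q2 s - Q1 s.
Proof.
have [B0 Bbeta betaM1 M12] := bounds.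
move=> bs ss0 s0M V12.
apply: (@deriv_le0_ge _ (fun t => Q2 t - Q1 t)) => // t ts.
  have bt : beta <= t by lra.
  by have := cont_serrin NL br1 bt; have := cont_serrin NL br2 bt => ? ?; continuity.
have t1 : beta < t < M1 by lra. have t2 : beta < t < M2 by lra.
eexists; first exact: deriv_sub (deriv_serrin NL br2 t2) (deriv_serrin NL br1 t1).
rewrite -mulrBr mulr_le0_ge0//.
  rewrite mulN1r oppr_le0; apply: (serrin_rate_ge0 NL); lra.
by rewrite subr_ge0; apply: V12; lra.
Qed.

Let flux2_gt0 {s : R} : 0 < s -> s <= M1 -> 0 < V2 s.
Proof.
have [B0 Bbeta betaM1 M12] := bounds; move=> s_gt0 sM1.
rewrite mulr_gt0 ?exprn_gt0//; first by apply: (br_r br2); lra.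
by apply: (br_y br2); lra.
Qed.

Let omega t := V1 t / V2 t.

Let omega_cont {s : R} : 0 < s -> s <= M1 -> {for s, continuous omega}.
Proof.
move=> s_gt0 sM1; have V20 := flux2_gt0 s_gt0 sM1.
have := cont_flux br1 s_gt0; have := cont_flux br2 s_gt0 => ? ?.
by rewrite /omega /V1 /V2; continuity; rewrite gt_eqF.
Qed.

(** The logarithmic derivative of a flux is [- f / y^2]. *)
Let deriv_omega {s : R} : 0 < s < M1 ->
  is_derive s 1 omega (- omega s * f s * (y1 s ^- 2 - y2 s ^- 2)).
Proof.
have [B0 Bbeta betaM1 M12] := bounds; move=> s1.
have s2 : 0 < s < M2 by lra.
have V20 : 0 < V2 s by apply: flux2_gt0; lra.
have ys1 := br_y br1 s1; have ys2 := br_y br2 s2.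
have rs1 : 0 < r1 s by apply: (br_r br1); lra.
have rs2 : 0 < r2 s by apply: (br_r br2); lra.
have A1 : 0 < r1 s ^+ p.+1 by rewrite exprn_gt0.
have A2 : 0 < r2 s ^+ p.+1 by rewrite exprn_gt0.
have V2n0 : V2 s != 0 by rewrite gt_eqF.
apply: is_derive_eq.
  exact: deriv_mul (deriv_flux br1 s1) (deriv_inv V2n0 (deriv_flux br2 s2)).
by rewrite /omega /V1 /V2 /flux; field; rewrite !gt_eqF.
Qed.

Let omega_ge {s s0 : R} : B <= s -> s <= s0 -> s0 <= M1 ->
  (forall x, s < x <= s0 -> 0 < y2 x - y1 x) -> omega s0 <= omega s.
Proof.
have [B0 Bbeta betaM1 M12] := bounds.
move=> Bs ss0 s0M y21; apply: deriv_le0_ge => // t ts.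
  by apply: omega_cont; lra.
have t1 : 0 < t < M1 by lra. have t2 : 0 < t < M2 by lra.
eexists; first exact: (deriv_omega t1).
have yt1 := br_y br1 t1; have yt2 := br_y br2 t2.
have V20 : 0 < V2 t by apply: flux2_gt0; lra.
have rt1 : 0 < r1 t by apply: (br_r br1); lra.
have ft : 0 < f t by apply: (nl_fpos NL); lra.
have yt : y1 t < y2 t by rewrite -subr_gt0; apply: y21; lra.
rewrite !mulNr oppr_le0 mulr_ge0//.
  by rewrite !mulr_ge0 ?invr_ge0 ?exprn_ge0 ?ltW.
rewrite subr_ge0 lef_pV2 ?posrE ?exprn_gt0//.
exact/ltW/pow_lt.
Qed.

(* While V1 <= V2 the functionals stay ordered; once V1 > V2, it is
   [Q1 - (V1 / V2) Q2] that keeps its sign, because the derivatives of Q1 and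
   Q2 are proportional to V1 and V2 with the same factor. *)
Let serrin_dichotomy {s s0 : R} : beta <= s -> s < s0 -> s0 <= M1 ->
  (forall x, s < x <= s0 -> 0 < y2 x - y1 x) ->
  V1 s0 < V2 s0 -> Q1 s0 < Q2 s0 -> (forall x, beta <= x <= s0 -> 0 < Q2 x) ->
  V1 s <= V2 s /\ Q1 s < Q2 s \/ Q1 s * V2 s < Q2 s * V1 s.
Proof.
have [B0 Bbeta betaM1 M12] := bounds.
move=> bs ss0 s0M y21 V12 Q12 Q2_gt0.
have le1 x : s <= x <= s0 -> (omega x <= 1) = (V1 x <= V2 x).
  move=> xs; rewrite /omega ler_pdivrMr ?mul1r//; apply: flux2_gt0; lra.
have mono x z : s <= x -> x <= z -> z <= s0 -> omega z <= omega x.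
  move=> sx xz zs; apply: omega_ge; [lra..|].
  by move=> t tz; apply: y21; lra.
have low x : s <= x <= s0 -> omega x <= 1 -> Q1 x < Q2 x.
  move=> xs ox.
  suff : Q2 s0 - Q1 s0 <= Q2 x - Q1 x by lra.
  apply: serrin_gap; [lra..|] => z zs.
  by rewrite -le1; [apply: le_trans ox; apply: mono|]; lra.
have [os|os] := leP (omega s) 1.
  left; split; last by apply: low => //; rewrite lexx ltW.
  by rewrite -le1// lexx ltW.
right.
have o0 : omega s0 < 1.
  by rewrite /omega ltr_pdivrMr ?mul1r//; apply: flux2_gt0; lra.
(* At [c] the fluxes agree: [serrin_gap] covers the values above it, and the combination with
   [omega] those below. *)
have [c] : exists2 c, c \in `[s, s0]%R & omega c = 1.
  apply: IVT; first exact: ltW.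
    by apply: continuous_within_cc => x xs; apply: omega_cont; lra.
  by rewrite ge_min le_max (ltW o0) (ltW os) orbT.
rewrite in_itv/= => cs oc.
have Qc : Q1 c < Q2 c by apply: low => //; rewrite oc.
have V20 : 0 < V2 s by apply: flux2_gt0; lra.
suff : Q1 s - omega s * Q2 s <= Q1 c - omega c * Q2 c.
  rewrite oc mul1r => h.
  have : Q1 s < omega s * Q2 s by lra.
  rewrite -(ltr_pM2r V20) => /lt_le_trans; apply.
  by rewrite mulrAC /omega divfK ?gt_eqF// mulrC.
apply: (@deriv_ge0_le _ (fun t => Q1 t - omega t * Q2 t)); first by lra.
  move=> t ts; have bt : beta <= t by lra.
  have t0 : 0 < t by lra. have tM : t <= M1 by lra.
  have := cont_serrin NL br1 bt; have := cont_serrin NL br2 bt.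
  by have := omega_cont t0 tM => ? ? ?; continuity.
move=> t ts.
have t1 : beta < t < M1 by lra. have t2 : beta < t < M2 by lra.
have t01 : 0 < t < M1 by lra. have t02 : 0 < t < M2 by lra.
have Vt : 0 < V2 t by apply: flux2_gt0; lra.
eexists.
  exact: deriv_sub (deriv_serrin NL br1 t1)
    (deriv_mul (deriv_omega t01) (deriv_serrin NL br2 t2)).
have yt1 := br_y br1 t01; have yt2 := br_y br2 t02.
(* The terms in [serrin_rate] cancel because [V1 = omega * V2]; only the derivative of [omega]
   contributes. *)
rewrite -/V1 -/V2 (_ : _ - _ =
  omega t * f t * (y1 t ^- 2 - y2 t ^- 2) * Q2 t); last first.
  by rewrite /Q2 /omega; field; rewrite !gt_eqF.
have rt1 : 0 < r1 t by apply: (br_r br1); lra.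
have ft : 0 < f t by apply: (nl_fpos NL); lra.
have yt : y1 t < y2 t by rewrite -subr_gt0; apply: y21; lra.
have Q2t : 0 < Q2 t by apply: Q2_gt0; lra.
rewrite !mulr_ge0 ?invr_ge0 ?exprn_ge0 ?(ltW Vt) ?(ltW rt1) ?(ltW yt1) ?(ltW ft) ?(ltW Q2t)//.
by rewrite subr_ge0 lef_pV2 ?posrE ?exprn_gt0//; exact/ltW/pow_lt.
Qed.

(** The factor [r ^+ p.+1] is shared with the flux, so the terms in [F / f] cancel in
    [Q1 * V2 - Q2 * V1]. *)
Let serrin_flux {r y : R -> R} {s : R} :
  serrin (-1) p f F r y s = r s ^+ p.+1 *
    (r s * (y s ^+ 2 + 2 * F s) - 2 * p.+2%:R * (F s / f s) * y s).
Proof. by rewrite /serrin /flux exprS; ring. Qed.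

(** At a first value with equal speeds, [r2 <= r1] refutes both alternatives of [serrin_dichotomy],
    so [y1 < y2] holds down to [beta]. There the same dichotomy gives [r1 y1 < r2 y2], which starts
    [falling_tail]. *)
Let falling_middle {s0 : R} : beta < s0 <= M1 -> r2 s0 <= r1 s0 ->
  y1 s0 < y2 s0 -> V1 s0 < V2 s0 -> Q1 s0 < Q2 s0 ->
  (forall x, beta <= x <= s0 -> 0 < Q2 x) -> False.
Proof.
have [B0 Bbeta betaM1 M12] := bounds.
move=> /andP[bs0 s0M] r21 y12 V12 Q12 Q2_gt0.
have y21 x : beta <= x <= s0 -> 0 < y2 x - y1 x.
  apply: (@barrier_down _ (fun x => y2 x - y1 x) beta s0).
  - exact: ltW.
  - move=> z /andP[bz _]; have z0 : 0 < z by lra.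
    by have := br_conty br1 z0; have := br_conty br2 z0 => ? ?; continuity.
  - by rewrite subr_gt0.
  move=> t /andP[bt ts0] y21 /eqP; rewrite subr_eq0 => /eqP yt.
  have t0 : 0 < t by lra.
  have rt := radius_ge t0 (ltW ts0) s0M r21 y21.
  have rt1 : 0 < r1 t by apply: (br_r br1); lra.
  have rt2 : 0 < r2 t by apply: (br_r br2); lra.
  have yt0 : 0 < y1 t by apply: (br_y br1); lra.
  have Et0 : 0 < y1 t ^+ 2 + 2 * F t by apply: (br_energy br1); lra.
  have [[V12t Q12t]|] := serrin_dichotomy bt ts0 s0M y21 V12 Q12 Q2_gt0.
    (* With equal speeds [V1 <= V2] means [r1 <= r2]; the radii then agree, and so do [Q1] and
       [Q2]. *)
    have re : r1 t = r2 t.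
      apply/eqP; rewrite eq_le rt andbT.
      by move: V12t; rewrite /V1 /V2 /flux yt ler_pM2r// ler_pXn2r// nnegrE ltW.
    by move: Q12t; rewrite /Q1 /Q2 !serrin_flux re yt ltxx.
  rewrite /Q1 /Q2 !serrin_flux /V1 /V2 /flux yt ltNge => /negP; apply.
  set E := _ + 2 * F t in Et0 *; set G := F t / f t.
  rewrite -subr_ge0 (_ : _ - _ = r1 t ^+ p.+1 * r2 t ^+ p.+1 * y1 t * E *
    (r1 t - r2 t)); last by ring.
  by rewrite mulr_ge0 ?subr_ge0// ltW// !mulr_gt0 ?exprn_gt0.
have bl : beta <= beta <= s0 by rewrite lexx ltW.
have b0 : 0 < beta by lra.
have yb : y1 beta < y2 beta by rewrite -subr_gt0; exact: y21.
have y21' x : beta < x <= s0 -> 0 < y2 x - y1 x by move=> xs; apply: y21; lra.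
have rb := radius_ge b0 (ltW bs0) s0M r21 y21'.
have rb1 : 0 < r1 beta by apply: (br_r br1); lra.
have rb2 : 0 < r2 beta by apply: (br_r br2); lra.
have yb1 : 0 < y1 beta by apply: (br_y br1); lra.
have yb2 : 0 < y2 beta by apply: (br_y br2); lra.
apply: (@falling_tail beta) => //; first by rewrite b0 lexx.
rewrite (nl_Fbeta NL) mulr0 !addr0 !sqrtr_sqr !gtr0_norm//.
rewrite ltNge; apply/negP => ry.
have [[_]|] := serrin_dichotomy (lexx beta) bs0 s0M y21' V12 Q12 Q2_gt0;
  rewrite /Q1 /Q2 !serrin_flux (nl_Fbeta NL) !(mul0r, mulr0, addr0, subr0).
  rewrite ltNge => /negP; apply.
  have E (r y : R) : r ^+ p.+1 * (r * y ^+ 2) = r ^+ p * (r * y) ^+ 2.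
    by rewrite exprS; ring.
  rewrite !E ler_pM ?exprn_ge0 ?mulr_ge0 ?(ltW rb2) ?(ltW yb2)//.
    exact: pow_le.
  by apply: pow_le => //; rewrite mulr_gt0.
rewrite /V1 /V2 /flux ltNge => /negP; apply.
rewrite -subr_ge0 (_ : _ - _ = r1 beta ^+ p.+1 * r2 beta ^+ p.+1 * y1 beta *
  y2 beta * (r1 beta * y1 beta - r2 beta * y2 beta)); last by ring.
by rewrite mulr_ge0 ?subr_ge0// ltW// !mulr_gt0 ?exprn_gt0.
Qed.

(** It suffices to find a value where [r2 <= r1] and [y1 < y2]: either [M1] itself, or the first
    crossing of the radii below it, which exists by [falling_radius_cross]. From there
    [falling_tail] concludes if the value is at most [beta], and [falling_middle] otherwise. *)
Lemma falling_contradiction : serrin (-1) p f F r1 y1 M1 <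
    serrin (-1) p f F r2 y2 M1 ->
  (forall x, beta <= x <= M1 -> 0 < serrin (-1) p f F r2 y2 x) -> False.
Proof.
have [B0 Bbeta betaM1 M12] := bounds.
move=> Q12 Q2_gt0; have M10 : 0 < M1 by lra.
have [r12M|r21M] := ltP (r1 M1) (r2 M1); last first.
  apply: (@falling_middle M1) => //; first by rewrite betaM1 lexx.
    by rewrite (br_yM br1).
  by rewrite [ltLHS]/V1 /flux (br_yM br1) mulr0 flux2_gt0.
have [[s [/andP[s0 sM] rs r12]]|H] := pselect (exists s : R, [/\ 0 < s < M1,
    r2 s - r1 s = 0 & forall x, s < x <= M1 -> 0 < r2 x - r1 x]); last first.
  apply: falling_radius_cross => s /andP[s0 sM]; rewrite -subr_ge0 ltW//.
  apply: (@barrier_down _ (fun x => r2 x - r1 x) s M1) => //.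
  - move=> x /andP[sx _]; have x0 : 0 < x by lra.
    by have := br_contr br1 x0; have := br_contr br2 x0 => ? ?; continuity.
  - by rewrite subr_gt0.
  - by move=> t ts r12 rt; apply: H; exists t; split=> //; lra.
  - by rewrite lexx.
have {}r12 x : s <= x <= M1 -> r1 x <= r2 x.
  move=> /andP[]; rewrite le_eqVlt => /predU1P[<- _|sx xM]; first by lra.
  by rewrite -subr_ge0 ltW// r12// sx.
have y12 x : s <= x -> x <= M1 -> y1 x < y2 x.
  move=> sx xM; apply: falling_speed_lt; [lra..|].
  by move=> z xz; apply: r12; lra.
have ys := y12 s (lexx s) (ltW sM).
have rs1 : 0 < r1 s by apply: (br_r br1); lra.
have ys1 : 0 < y1 s by apply: (br_y br1); lra.
have [sb|bs] := leP s beta.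
  apply: (@falling_tail s); rewrite ?s0//; first by lra.
  have -> : r2 s = r1 s by lra.
  rewrite ltr_pM2l// ltr_sqrt; first by rewrite ltrD2r; exact: pow_lt.
  by apply: (br_energy br2); lra.
have V12 x : s <= x <= M1 -> V1 x <= V2 x.
  move=> xs; rewrite /V1 /V2 /flux.
  have rx : 0 < r1 x by apply: (br_r br1); lra.
  have yx : y1 x < y2 x by apply: y12; lra.
  apply: ler_pM; rewrite ?exprn_ge0 ?(ltW rx)//.
  - by apply: (br_y_ge0 br1); lra.
  - by apply: pow_le => //; apply: r12.
  - exact: ltW.
apply: (@falling_middle s); first by lra.
- by lra.
- by [].
- have -> : V1 s = r2 s ^+ p.+1 * y1 s by rewrite /V1 /flux; congr (_ ^+ _ * _); lra.
  by rewrite ltr_pM2l// exprn_gt0//; lra.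
- have := serrin_gap (ltW bs) (ltW sM) (lexx _) V12.
  by rewrite -subr_gt0; apply: lt_le_trans; rewrite subr_gt0.
- by move=> x xs; apply: Q2_gt0; lra.
Qed.

End FallingBranches.

(** * Branches of a solution *)

(** With [g] defined on the whole line, the inverse is continuous from both sides at every value
    above [lo], including the images of the endpoints of a monotone piece. *)
Lemma increasing_inverse {R : realType} (g : R -> R) (lo : R) :
  (forall x, {for x, continuous g}) -> (forall x y, x < y -> g x < g y) ->
  (forall s, lo < s -> exists x y, g x <= s /\ s <= g y) ->
  exists h : R -> R, [/\ forall s, lo < s -> g (h s) = s,
    forall s, lo < s -> {for s, continuous h} &
    forall x l, lo < g x -> is_derive x 1 g l -> l != 0 ->
      is_derive (g x) 1 h l^-1].
Proof.
move=> cg ig rg.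
have ing x y : (g x < g y) = (x < y).
  apply/idP/idP; last exact: ig.
  rewrite !ltNge; apply: contra; rewrite le_eqVlt => /predU1P[->//|/ig/ltW//].
have inj x y : g x = g y -> x = y.
  by move=> gxy; apply/eqP; rewrite eq_le !leNgt -(ing x y) -(ing y x) gxy ltxx.
pose h s := xget 0 [set x | g x = s].
have gh s : lo < s -> g (h s) = s.
  move=> los; have [x [y [gx gy]]] := rg s los.
  have xy : x <= y.
    by rewrite leNgt; apply/negP => /ig; rewrite ltNge (le_trans gx gy).
  have [c _ gc] : exists2 c, c \in `[x, y]%R & g c = s.
    apply: IVT => //; first by apply: continuous_within_cc.
    by rewrite ge_min gx le_max gy orbT.
  by apply: (@xgetPex _ 0 [set x | g x = s]); exists c.
exists h; split=> //.
- move=> s los; apply/cvgrPdist_lt => e e0; near=> z.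
  have loz : lo < z by near: z; exact: lt_nbhsr.
  rewrite distrC ltr_distl -(ing _ (h z)) -(ing (h z)) gh//; apply/andP; split.
    near: z; apply: lt_nbhsr; rewrite -[ltRHS](gh s los) ing; lra.
  near: z; apply: lt_nbhsl; rewrite -[ltLHS](gh s los) ing; lra.
- move=> x l lox dg l0; apply: is_derive_inverse dg l0.
    near=> z; apply: inj; rewrite gh//.
    by near: z; exact: (cg x _ (lt_nbhsr lox)).
  by near=> z; exact: cg.
Unshelve. all: by end_near. Qed.

(* Only the values of [u] and of its derivative [v] on [a, +oo[ matter;
   both are extended to continuous functions on the whole line. *)
Record profile (R : realType) (p : nat) (f : R -> R) (a : R) (u v : R -> R)
  : Prop := Profile {
  pr_a : 0 < a;
  pr_contu : forall r : R, {for r, continuous u};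
  pr_contv : forall r : R, {for r, continuous v};
  pr_du : forall r : R, a < r -> is_derive r 1 u (v r);
  pr_dv : forall r : R, a < r ->
    is_derive r 1 v (- (p.+1%:R / r) * v r - f (u r));
  pr_ua : u a = 0;
  pr_pos : forall r : R, a < r -> 0 < u r;
  pr_lim : forall e : R, 0 < e -> exists r0 : R, forall r, r0 <= r -> u r < e }.

Arguments pr_a {R p f a u v}.
Arguments pr_contu {R p f a u v}.
Arguments pr_contv {R p f a u v}.
Arguments pr_du {R p f a u v} _ {r} _.
Arguments pr_dv {R p f a u v} _ {r} _.
Arguments pr_ua {R p f a u v}.
Arguments pr_pos {R p f a u v} _ {r} _.
Arguments pr_lim {R p f a u v} _ {e} _.

Lemma deriv_lt0_decreasing {R : realType} (g dg : R -> R) (x y : R) : x < y ->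
  (forall z, x <= z <= y -> {for z, continuous g}) ->
  (forall z, x < z < y -> is_derive z 1 g (dg z)) ->
  (forall z, x < z < y -> dg z < 0) -> g y < g x.
Proof.
move=> xy cg dg1 dg0.
have [c] := @MVT _ g dg x y xy (fun z => dg1 z) (continuous_within_cc _ _ _ cg).
rewrite in_itv/= => /dg0 dc e; rewrite -subr_lt0 e nmulr_rlt0// subr_gt0//.
Qed.

(** * Positivity of the energy and the single critical point of a solution *)

Section Profile.
Context {R : realType} {p : nat} {f F : R -> R} {B beta : R}.
Hypothesis NL : nonlinearity R p f F B beta.
Context {a : R} {u v : R -> R}.
Hypothesis pr : profile R p f a u v.

Let a_gt0 : 0 < a. Proof. exact: (pr_a pr). Qed.

Lemma profile_ge0 {r} : a <= r -> 0 <= u r.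
Proof.
by rewrite le_eqVlt => /predU1P[<-|/(pr_pos pr)/ltW//]; rewrite (pr_ua pr).
Qed.

Let energy r := v r ^+ 2 + 2 * F (u r).

Let cont_energy {r} : a <= r -> {for r, continuous energy}.
Proof.
move=> ar; have := pr_contv pr r.
have := cont_comp (pr_contu pr r) (nl_contF NL (profile_ge0 ar)).
by move=> ? ?; rewrite /energy; continuity.
Qed.

Let deriv_energy {r} : a < r ->
  is_derive r 1 energy (- (2 * p.+1%:R / r * v r ^+ 2)).
Proof.
move=> ar; have a0 := a_gt0; have r0 : r != 0 by rewrite gt_eqF//; lra.
apply: is_derive_eq.
  exact: deriv_add (deriv_sqr (pr_dv pr ar))
    (deriv_scale 2 (deriv_comp (nl_derF NL (pr_pos pr ar)) (pr_du pr ar))).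
by field.
Qed.

Let energy_le {r s} : a <= r -> r <= s -> energy s <= energy r.
Proof.
move=> ar rs; have a0 := a_gt0.
apply: deriv_le0_ge => // t ts; first by apply: cont_energy; lra.
have at' : a < t by lra.
eexists; first exact (deriv_energy at').
by rewrite oppr_le0 mulr_ge0 ?sqr_ge0// divr_ge0 ?mulr_ge0//; lra.
Qed.

(** A negative value would bound all later energies from above, while [u] tending to 0 brings
    [2 * F (u r)] back above it. *)
Let energy_ge0 {r} : a <= r -> 0 <= energy r.
Proof.
move=> ar; rewrite leNgt; apply/negP => Er.
have /cvgrPdist_lt : {for 0, continuous F} by exact: (nl_contF NL (lexx 0)).
move=> /(_ (- energy r / 2)); rewrite (nl_F0 NL) divr_gt0 ?oppr_gt0//.
move=> /(_ isT) [d /= d0 Fd].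
have [r0 hr0] := pr_lim pr d0.
have rm : r <= Num.max r r0 by rewrite le_max lexx.
have am : a <= Num.max r r0 by rewrite (le_trans ar).
have um := hr0 (Num.max r r0); rewrite le_max lexx orbT in um.
have um0 := profile_ge0 am.
have := Fd (u (Num.max r r0)); rewrite /= !sub0r !normrN ger0_norm// um//.
move=> /(_ isT); have := energy_le ar rm; rewrite {1}/energy.
have := sqr_ge0 (v (Num.max r r0)).
rewrite ltr_norml; lra.
Qed.

(** If the energy vanished at [r] it would vanish from there on; its derivative then forces [v = 0],
    so [u] would be a positive constant and could not tend to 0. *)
Lemma profile_energy_gt0 {r} : a <= r -> 0 < v r ^+ 2 + 2 * F (u r).
Proof.
move=> ar; rewrite lt_neqAle energy_ge0// andbT eq_sym; apply/eqP => Er.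
have a0 := a_gt0.
have E0 s : r <= s -> energy s = 0.
  move=> rs; apply/eqP; rewrite eq_le energy_ge0 ?(le_trans ar)// andbT -[X in _ <= X]Er.
  exact: energy_le.
have v0 s : r < s -> v s = 0.
  move=> rs; have as' : a < s by lra.
  have dE := deriv_energy as'.
  have : is_derive s 1 energy 0.
    apply: near_eq_is_derive (is_derive_cst (0 : R) s 1).
    near=> z; rewrite /cst E0// ltW//; near: z; exact: lt_nbhsr.
  move=> [_ e0]; have := @derive_val _ _ _ _ _ _ _ dE; rewrite e0 => /esym/eqP.
  rewrite oppr_eq0 mulf_eq0 sqrf_eq0 gt_eqF/= => [/eqP//|].
  by rewrite divr_gt0 ?mulr_gt0//; lra.
have r1 : a < r + 1 by lra.
have [r0 hr0] := pr_lim pr (pr_pos pr r1).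
pose m := Num.max (r + 1) r0.
have mr : r + 1 <= m by rewrite /m le_max lexx.
have : u m < u (r + 1) by apply: hr0; rewrite /m le_max lexx orbT.
rewrite ltNge => /negP; apply.
apply: deriv_ge0_le => // s sm; first exact: (pr_contu pr).
have as' : a < s by lra.
by eexists; [exact (pr_du pr as')|rewrite v0//; lra].
Unshelve. all: by end_near. Qed.

(** The energy at [a] is [v a ^+ 2], so the slope is nonzero; a negative slope would push [u] below
    0 just after [a]. *)
Lemma profile_va : 0 < v a.
Proof.
have a0 := a_gt0.
have := profile_energy_gt0 (lexx a); rewrite (pr_ua pr) (nl_F0 NL) mulr0 addr0.
rewrite exprn_even_gt0//= => va; rewrite lt_neqAle eq_sym va/= leNgt.
apply/negP => va0.
have [|e e0 he] := continuous_gt0_near _ _ (cont_opp (pr_contv pr a)).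
  by rewrite oppr_gt0.
have ae : a < a + e / 2 by lra.
have : u (a + e / 2) < u a.
  apply: (@deriv_lt0_decreasing _ u v) => // z az; first exact: (pr_contu pr).
    by apply: (pr_du pr); lra.
  by rewrite -oppr_gt0; apply: he; rewrite ltr_distl; lra.
by rewrite (pr_ua pr) ltNge profile_ge0// ltW.
Qed.

Let crit_value {r} : a < r -> v r = 0 -> beta < u r.
Proof.
move=> ar vr; rewrite ltNge; apply/negP => ub.
have := profile_energy_gt0 (ltW ar); rewrite vr expr0n/= add0r.
have : F (u r) <= 0 by apply: (nl_Fle0 NL); rewrite ub profile_ge0// ltW.
by lra.
Qed.

(* At a critical point u'' = - f u < 0. *)
Let crit_near {r} : a < r -> v r = 0 -> exists2 e, 0 < e &
  (forall z, r - e < z < r -> 0 < v z) /\ (forall z, r < z < r + e -> v z < 0).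
Proof.
move=> ar vr.
have := pr_dv pr ar; rewrite vr mulr0 sub0r => dv.
have fr : 0 < f (u r).
  by apply: (nl_fpos NL); have := nl_beta NL; have := crit_value ar vr; lra.
have /is_derive1_caratheodory[h [hE hc hr]] := dv.
have [||e e0 he] := @continuous_gt0_near _ (fun z => - h z) r.
- exact: cont_opp.
- by rewrite hr opprK.
exists e => //; split=> z zr; have := hE z; rewrite vr subr0 => ->.
  have hz : 0 < - h z by apply: he; rewrite ltr_distl; lra.
  by rewrite nmulr_rgt0; lra.
have hz : 0 < - h z by apply: he; rewrite ltr_distl; lra.
by rewrite nmulr_rlt0; lra.
Qed.

(** A zero of [v] exists, since otherwise [u] would increase and not tend to 0. By [crit_near], [v]
    passes from positive to negative at each of its zeros beyond [a], which excludes a second one on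
    either side. *)
Lemma profile_peak : exists t, [/\ a < t, v t = 0,
  forall r, a <= r < t -> 0 < v r & forall r, t < r -> v r < 0].
Proof.
have a0 := a_gt0; have va := profile_va.
have [t [at' vt]] : exists t, a < t /\ v t = 0.
  have [r [ar vr]] : exists r, a < r /\ v r <= 0.
    apply: contrapT => H.
    have vpos r : a < r -> 0 < v r.
      by move=> ar; rewrite ltNge; apply/negP => vr; apply: H; exists r.
    have a1 : a < a + 1 by lra.
    have [r0 hr0] := pr_lim pr (pr_pos pr a1).
    pose m := Num.max (a + 1) r0.
    have ma : a + 1 <= m by rewrite /m le_max lexx.
    have : u m < u (a + 1) by apply: hr0; rewrite /m le_max lexx orbT.
    rewrite ltNge => /negP; apply.
    apply: deriv_ge0_le => // s sm; first exact: (pr_contu pr).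
    have as' : a < s by lra.
    by eexists; [exact (pr_du pr as')|rewrite ltW// vpos].
  have [t] : exists2 t, t \in `[a, r]%R & v t = 0.
    apply: IVT; [exact: ltW|by apply: continuous_within_cc => x _; exact: (pr_contv pr)|].
    by rewrite ge_min vr orbT le_max (ltW va).
  rewrite in_itv/= => /andP[at' _] vt; exists t; split=> //.
  by rewrite lt_neqAle at' andbT; apply/eqP => e; move: va; rewrite e vt ltxx.
have [e e0 [el er]] := crit_near at' vt.
exists t; split=> // r.
  move=> /andP[ar rt].
  have [re|re] := ltP (t - e) r; first by apply: el; rewrite re.
  have ate : a <= Num.max a (t - e / 2) by rewrite le_max lexx.
  have mt : Num.max a (t - e / 2) < t by rewrite gt_max at'/=; lra.
  have met : t - e < Num.max a (t - e / 2) by rewrite lt_max; apply/orP; right; lra.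
  have rm : r <= Num.max a (t - e / 2) by lra.
  apply: (@barrier_down _ v r (Num.max a (t - e / 2))) => //.
  - by move=> x _; exact: (pr_contv pr).
  - by apply: el; rewrite met.
  - move=> s /andP[rs sm] vpos vs.
    have [sa|sa] := eqVneq s a; first by move: va; rewrite -sa vs ltxx.
    have as' : a < s by rewrite lt_neqAle eq_sym sa; lra.
    have [e' e'0 [_ er']] := crit_near as' vs.
    (* Just right of [s], [crit_near] makes [v] negative while the barrier keeps it positive. *)
    pose z := Num.min (Num.max a (t - e / 2)) (s + e' / 2).
    have zm : z <= Num.max a (t - e / 2) by rewrite /z ge_min lexx.
    have ze : z <= s + e' / 2 by rewrite /z ge_min lexx orbT.
    have sz : s < z by rewrite /z lt_min sm/=; lra.
    have := vpos z; rewrite sz zm => /(_ isT).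
    by rewrite ltNge ltW// er'// sz/=; lra.
  - by rewrite lexx.
move=> tr.
have [re|re] := ltP r (t + e); first by apply: er; rewrite tr.
rewrite -oppr_gt0; apply: (@barrier_up _ (fun z => - v z) (t + e / 2) r).
- by lra.
- by move=> x _; apply: cont_opp; exact: (pr_contv pr).
- by rewrite oppr_gt0; apply: er; lra.
- move=> s /andP[ts sr] vneg /eqP; rewrite oppr_eq0 => /eqP vs.
  have as' : a < s by lra.
  have [e' e'0 [el' _]] := crit_near as' vs.
  pose z := Num.max (t + e / 2) (s - e' / 2).
  have zm : t + e / 2 <= z by rewrite /z le_max lexx.
  have ze : s - e' / 2 <= z by rewrite /z le_max lexx orbT.
  have zs : z < s by rewrite /z gt_max ts/=; lra.
  have := vneg z; rewrite zs zm => /(_ isT).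
  by rewrite oppr_gt0 ltNge ltW// el'// zs andbT; lra.
- by lra.
Qed.

End Profile.

(** * Inverse functions of the rising and falling pieces *)

Section Branches.
Context {R : realType} {p : nat} {f F : R -> R} {B beta : R}.
Hypothesis NL : nonlinearity R p f F B beta.
Context {a : R} {u v : R -> R}.
Hypothesis pr : profile R p f a u v.
Context {t : R}.
Hypothesis at_ : a < t.
Hypothesis vt : v t = 0.
Hypothesis v_pos : forall r, a <= r < t -> 0 < v r.
Hypothesis v_neg : forall r, t < r -> v r < 0.

Lemma rising_lt {x y} : a <= x -> x < y -> y <= t -> u x < u y.
Proof.
move=> ax xy yt; rewrite -ltrN2.
apply: (@deriv_lt0_decreasing _ (fun r => - u r) (fun r => - v r));
  [exact: xy|move=> z zxy..].
- by apply: cont_opp; exact: (pr_contu pr).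
- by apply: deriv_opp; apply: (pr_du pr); lra.
- by rewrite oppr_lt0 v_pos//; lra.
Qed.

Lemma falling_lt {x y} : t <= x -> x < y -> u y < u x.
Proof.
move=> tx xy; have at0 := at_.
apply: (@deriv_lt0_decreasing _ u v) => // z zxy.
- exact: (pr_contu pr).
- by apply: (pr_du pr); lra.
- by apply: v_neg; lra.
Qed.

Let cont_min (c x : R) : {for x, continuous (fun r => Num.min c r)}.
Proof. by apply: (@continuous_min _ _ (fun=> c) (fun r => r)); [exact: cont_cst|exact: cont_id]. Qed.

Let cont_max (c x : R) : {for x, continuous (fun r => Num.max c r)}.
Proof. by apply: (@continuous_max _ _ (fun=> c) (fun r => r)); [exact: cont_cst|exact: cont_id]. Qed.

Lemma rising_branch : exists r : R -> R,
  [/\ branch R 1 p f F (u t) r (fun s => v (r s)),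
      forall s, 0 <= s -> {for s, continuous r},
      forall s, 0 <= s <= u t -> a <= r s <= t /\ u (r s) = s &
      forall x, a <= x <= t -> r (u x) = x].
Proof.
have at0 := at_; have a0 := pr_a pr; have ua := pr_ua pr.
have ut : 0 < u t by exact: (pr_pos pr).
(* The piece of [u] on [[a, t]] is continued on both sides by lines of slope 1, giving a strictly
   increasing function on the line. *)
pose g x := u (Num.max a (Num.min t x)) + (Num.min a x - a) + (Num.max t x - t).
have gE x : a <= x -> x <= t -> g x = u x.
  by move=> ax xt; rewrite /g (min_idPr xt) (max_idPr ax) (min_idPl ax) (max_idPl xt) !subrr !addr0.
have gl x : x <= a -> g x = x - a.
  move=> xa; have xt : x <= t by lra.
  by rewrite /g (min_idPr xt) (max_idPl xa) (min_idPr xa) (max_idPl xt) ua subrr addr0 add0r.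
have gr x : t <= x -> g x = u t + (x - t).
  move=> tx; have ax : a <= x by lra.
  by rewrite /g (min_idPl tx) (max_idPr (ltW at0)) (min_idPl ax) (max_idPr tx) subrr addr0.
have cg x : {for x, continuous g}.
  have cu : {for x, continuous (fun x => u (Num.max a (Num.min t x)))}.
    apply: (cont_comp _ (pr_contu pr _)); apply: (cont_comp (cont_min t x)).
    exact: cont_max.
  have := cont_min a x; have := cont_max t x => ? ?.
  by rewrite /g; continuity.
have ig x y : x < y -> g x < g y.
  move=> xy; have uge z : a <= z -> z <= t -> 0 <= u z <= u t.
    move=> az zt; rewrite (profile_ge0 pr)//=.
    by move: zt; rewrite le_eqVlt => /predU1P[->//|zt]; apply/ltW/rising_lt.
  have [xa|ax] := ltP x a.
    rewrite (gl x (ltW xa)); have [ya|ay] := leP y a; first by rewrite gl//; lra.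
    have [yt|ty] := leP y t; first by rewrite gE//; [have := uge y; lra|lra].
    by rewrite gr//; lra.
  have [xt|tx] := ltP x t; last by rewrite !gr//; lra.
  rewrite (gE x ax (ltW xt)); have [yt|ty] := leP y t.
    by rewrite gE//; [exact: rising_lt|lra].
  rewrite gr; last by lra.
  by have := rising_lt ax xt (lexx t); lra.
(* The bound [-1] lies below [u a = 0], so that the inverse is continuous at 0 too. *)
have [|r [rK cr dr]] := increasing_inverse g (-1) cg ig.
  move=> s s1; exists (a - `|s|), (t + `|s|); have s0 := normr_ge0 s.
  rewrite gl ?gr; [|lra..].
  by have := ler_norm s; have := ler_normr s; have := lerNnormlW (lexx `|s|); lra.
have inv x : -1 < g x -> r (g x) = x.
  move=> /rK rgx; apply/eqP; rewrite eq_le !leNgt.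
  by apply/andP; split; apply/negP => /ig; rewrite rgx ltxx.
have ru x : a <= x <= t -> r (u x) = x.
  move=> /andP[ax xt]; rewrite -gE// inv// gE//.
  by have := profile_ge0 pr ax; lra.
have rr s : 0 <= s <= u t -> a <= r s <= t /\ u (r s) = s.
  move=> /andP[s0 st]; have s1 : -1 < s by lra.
  have art : a <= r s <= t.
    rewrite !leNgt; apply/andP; split; apply/negP => /ig; rewrite rK//.
      by rewrite gl// subrr; lra.
    by rewrite (gr t (lexx _)) subrr; lra.
  by split=> //; rewrite -gE ?rK//; lra.
have rs s : 0 < s < u t -> a < r s < t.
  move=> st; have [|/andP[ar rt] us] := rr s; first by lra.
  rewrite !lt_neqAle ar rt !andbT; apply/andP; split; apply/eqP => e.
    by move: us; rewrite -e ua; lra.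
  by move: us; rewrite e; lra.
have dr' s : 0 < s < u t -> is_derive s 1 r (v (r s))^-1.
  move=> st; have [|_ us] := rr s; first by lra.
  have /andP[ars rst] := rs s st.
  have gs : g (r s) = s by rewrite rK//; lra.
  rewrite -[X in is_derive X]gs; apply: dr; first by rewrite gs; lra.
    apply: near_eq_is_derive (pr_du pr ars).
    near=> z; rewrite gE//; apply: ltW; near: z.
      exact: lt_nbhsr.
    exact: lt_nbhsl.
  by rewrite gt_eqF// v_pos// rst ltW.
have cr0 s : 0 <= s -> {for s, continuous r} by move=> s0; apply: cr; lra.
exists r; split; [split|exact: cr0|exact: rr|exact: ru].
- exact: ut.
- by move=> s s0; apply: cr; lra.
- move=> s s0; apply: (cont_comp _ (pr_contv pr _)); apply: cr; lra.
- by move=> s st; have [|/andP[ar _] _] := rr s; lra.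
- by move=> s st; have := rs s st => /andP[ar rt]; apply: v_pos; rewrite rt ltW.
- by rewrite ru// lexx ltW.
- by move=> s st; rewrite mul1r; exact: dr'.
- move=> s st; have /andP[ars rst] := rs s st; have [|_ us] := rr s; first by lra.
  apply: is_derive_eq (deriv_comp (pr_dv pr ars) (dr' s st)) _.
  have vr : 0 < v (r s) by rewrite v_pos// rst ltW.
  by rewrite us; field; rewrite !gt_eqF//; lra.
- move=> s st; have [|/andP[ar _] us] := rr s; first by lra.
  by have := profile_energy_gt0 NL pr ar; rewrite us.
Unshelve. all: by end_near. Qed.

Lemma falling_branch : exists r : R -> R,
  [/\ branch R (-1) p f F (u t) r (fun s => - v (r s)),
      forall s, 0 < s <= u t -> t <= r s /\ u (r s) = s &
      forall x, t <= x -> r (u x) = x].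
Proof.
have at0 := at_; have a0 := pr_a pr.
have ut : 0 < u t by exact: (pr_pos pr).
(* The reflection of the radius turns the falling piece into an increasing function; the radius is
   recovered as minus the inverse. *)
pose g x := u (Num.max t (- x)) + (t - Num.min t (- x)).
have gE x : t <= x -> g (- x) = u x.
  by move=> tx; rewrite /g opprK (max_idPr tx) (min_idPl tx) subrr addr0.
have gr x : x <= t -> g (- x) = u t + (t - x).
  by move=> xt; rewrite /g opprK (max_idPl xt) (min_idPr xt).
have cg x : {for x, continuous g}.
  have cN : {for x, continuous (fun z : R => - z)} by apply: cont_opp; exact: cont_id.
  have cu : {for x, continuous (fun x => u (Num.max t (- x)))}.
    apply: (cont_comp _ (pr_contu pr _)); apply: (cont_comp cN).
    exact: cont_max.
  have := cont_comp cN (cont_min t (- x)) => ?.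
  by rewrite /g; continuity.
have ig x y : x < y -> g x < g y.
  move=> xy; rewrite -[x]opprK -[y]opprK.
  have [tx|xt] := leP t (- x); last by rewrite !gr; lra.
  rewrite (gE (- x))//; have [ty|yt] := leP t (- y).
    by rewrite gE//; apply: falling_lt => //; lra.
  rewrite gr; last by lra.
  move: tx; rewrite le_eqVlt => /predU1P[<-|tx]; first by lra.
  by have := falling_lt (lexx t) tx; lra.
have [|r [rK cr dr]] := increasing_inverse g 0 cg ig.
  move=> s s0; have [r0 hr0] := pr_lim pr s0.
  exists (- Num.max t r0), (- (t - s)); split.
    by rewrite gE ?le_max ?lexx// ltW// hr0// le_max lexx orbT.
  by rewrite gr; lra.
have inv x : 0 < g x -> r (g x) = x.
  move=> /rK rgx; apply/eqP; rewrite eq_le !leNgt.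
  by apply/andP; split; apply/negP => /ig; rewrite rgx ltxx.
have ru x : t <= x -> - r (u x) = x.
  move=> tx; rewrite -gE// inv ?opprK// gE//.
  by apply: (pr_pos pr); lra.
have rr s : 0 < s <= u t -> t <= - r s /\ u (- r s) = s.
  move=> /andP[s0 st].
  have trs : t <= - r s.
    rewrite leNgt; apply/negP => rt.
    have : g (- t) < g (r s) by apply: ig; lra.
    by rewrite rK// gE//; lra.
  by split=> //; rewrite -gE// opprK rK.
have rs s : 0 < s < u t -> t < - r s.
  move=> st; have [|tr us] := rr s; first by lra.
  rewrite lt_neqAle tr andbT; apply/eqP => e.
  by move: us; rewrite -e; lra.
have dr' s : 0 < s < u t -> is_derive s 1 (fun s => - r s) (v (- r s))^-1.
  move=> st; have [|_ us] := rr s; first by lra.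
  have trs := rs s st.
  have gs : g (r s) = s by rewrite rK//; lra.
  have -> : (v (- r s))^-1 = - (- v (- r s))^-1 by rewrite invrN opprK.
  apply: deriv_opp.
  rewrite -[X in is_derive X]gs; apply: dr; first by rewrite gs; lra.
    have arst : a < - r s by lra.
    have dN : is_derive (r s) 1 (fun z : R => - z) (-1).
      by apply: deriv_opp; exact: deriv_id.
    have : is_derive (r s) 1 (fun z => u (- z)) (v (- r s) * -1).
      exact: (deriv_comp (pr_du pr arst) dN).
    rewrite mulrN1; apply: near_eq_is_derive.
    near=> z; rewrite -[z in RHS]opprK gE//; apply: ltW.
    have : z < - t by near: z; apply: lt_nbhsl; lra.
    by lra.
  by rewrite oppr_eq0 lt_eqF// v_neg.
exists (fun s => - r s); split; [split|exact: rr|exact: ru].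
- exact: ut.
- by move=> s s0; apply: cont_opp; exact: cr.
- move=> s s0; apply: cont_opp; apply: (cont_comp _ (pr_contv pr _)).
  by apply: cont_opp; exact: cr.
- by move=> s st; have [|tr _] := rr s; lra.
- by move=> s st; rewrite oppr_gt0; apply: v_neg; exact: rs.
- by rewrite ru// vt oppr0.
- by move=> s st; rewrite mulN1r invrN opprK; exact: dr'.
- move=> s st; have trs := rs s st; have [|_ us] := rr s; first by lra.
  have ars : a < - r s by lra.
  apply: is_derive_eq (deriv_opp
    (@deriv_comp _ v (fun z => - r z) s _ _ (pr_dv pr ars) (dr' s st))) _.
  have vr : v (- r s) < 0 by apply: v_neg; lra.
  by rewrite us; field; rewrite lt_eqF//= -oppr_eq0 gt_eqF//; lra.
- move=> s st; have [|tr us] := rr s; first by lra.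
  have ar : a <= - r s by lra.
  by have := profile_energy_gt0 NL pr ar; rewrite us sqrrN.
Unshelve. all: by end_near. Qed.

(** The mean value theorem on [[x, 2x]] gives [z] with [z |v z| < 2 x |v z| = 2 (u x - u (2x)) < 2 u
    x], and [u x] is small for large [x]. *)
Lemma falling_decay {r : R -> R} :
  (forall x, t <= x -> r (u x) = x) -> forall {c e : R}, 0 < c -> 0 < e ->
  exists s : R, [/\ 0 < s, s < c, 1 <= r s & r s * - v (r s) < e].
Proof.
move=> ru c e c0 e0; have at0 := at_; have a0 := pr_a pr.
have [x1 h1] := pr_lim pr c0.
have e20 : 0 < e / 2 by lra.
have [x2 h2] := pr_lim pr e20.
pose x := Num.max (Num.max t 1) (Num.max x1 x2).
have tx : t <= x by rewrite /x !le_max lexx.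
have x10 : 1 <= x by rewrite /x !le_max lexx orbT.
have uc : u x < c by apply: h1; rewrite /x !le_max lexx !orbT.
have ue : u x < e / 2 by apply: h2; rewrite /x !le_max lexx !orbT.
have x2x : x < 2 * x by lra.
have [z] : exists2 z, z \in `]x, (2 * x)[%R & u (2 * x) - u x = v z * (2 * x - x).
  apply: MVT => //.
    by move=> z; rewrite in_itv/= => xz; apply: (pr_du pr); lra.
  by apply: continuous_within_cc => z _; exact: (pr_contu pr).
rewrite in_itv/= => /andP[xz zx] uz.
have tz : t <= z by lra.
exists (u z); split.
- by apply: (pr_pos pr); lra.
- by apply: lt_trans uc; exact: falling_lt.
- by rewrite ru//; lra.
rewrite ru//.
have vz : v z < 0 by apply: v_neg; lra.
have u2 : 0 < u (2 * x) by apply: (pr_pos pr); lra.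
have : z * - v z < 2 * x * - v z by rewrite ltr_pM2r// oppr_gt0.
by lra.
Qed.

(** This is [serrin] with the radius as variable: a single function for both branches, which can be
    followed across the maximum. *)
Definition radial_serrin x := x ^+ p.+2 * (v x ^+ 2 + 2 * F (u x)) +
  2 * p.+2%:R * (F (u x) / f (u x) * (x ^+ p.+1 * v x)).

Lemma radial_serrin_le {c d : R} : a <= c -> c <= d ->
  (forall x, c <= x <= d -> beta <= u x) ->
  (forall x, c < x < d -> beta < u x) -> radial_serrin c <= radial_serrin d.
Proof.
move=> ac cd ub ub'; have a0 := pr_a pr.
apply: deriv_ge0_le => // x xcd.
  have := pr_contv pr x.
  have := cont_comp (pr_contu pr x) (nl_contG NL (ub x xcd)).
  have ax : a <= x by lra.
  have := cont_comp (pr_contu pr x) (nl_contF NL (profile_ge0 pr ax)).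
  by move=> ? ? ?; rewrite /radial_serrin; continuity.
have ax : a < x by lra.
have bx := ub' x xcd.
have fx : 0 < f (u x) by apply: (nl_fpos NL); have := nl_beta NL; lra.
have ux := pr_pos pr ax.
have x0 : x != 0 by rewrite gt_eqF//; lra.
have [k dG pk] := nl_K NL bx.
have du := pr_du pr ax; have dv := pr_dv pr ax.
have dx n : is_derive x 1 (fun z : R => z ^+ n) (n%:R * x ^+ n / x * 1).
  exact: (@deriv_pow _ (fun z => z) x 1 n x0 (deriv_id x)).
eexists.
  exact: deriv_add (deriv_mul (dx p.+2) (deriv_add (deriv_sqr dv)
     (deriv_scale 2 (deriv_comp (nl_derF NL ux) du))))
   (deriv_scale _ (deriv_mul (deriv_comp dG du) (deriv_mul (dx p.+1) dv))).
rewrite [leRHS](_ : _ = x ^+ p.+1 * v x ^+ 2 * (2 * p.+2%:R * k - p%:R)).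
  by rewrite mulr_ge0 ?subr_ge0// mulr_ge0 ?sqr_ge0// exprn_ge0//; lra.
rewrite [x ^+ p.+2]exprS -!natr1; field.
by rewrite x0 gt_eqF.
Qed.

End Branches.

(** * Exclusion of different initial slopes *)

Section Uniqueness.
Context {R : realType} {p : nat} {f F : R -> R} {B beta : R}.
Hypothesis NL : nonlinearity R p f F B beta.
Context {a : R} {u1 v1 u2 v2 : R -> R}.
Hypothesis pr1 : profile R p f a u1 v1.
Hypothesis pr2 : profile R p f a u2 v2.

(** The rising comparison orders the maxima and the functionals at [u1 t1]. Both branches of [u1]
    meet there at radius [t1], while the functional of [u2] grows from its rising to its falling
    branch, so the order passes to the falling branches. *)
Lemma initial_slope_not_lt : ~ v1 a < v2 a.
Proof.
move=> va12; have a0 := pr_a pr1.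
have [B0 Bb] := (nl_B NL, nl_beta NL).
have [t1 [at1 vt1 vp1 vn1]] := profile_peak NL pr1.
have [t2 [at2 vt2 vp2 vn2]] := profile_peak NL pr2.
have [l1 [bl1 cl1 ul1 lu1]] := rising_branch NL pr1 at1 vt1 vp1.
have [l2 [bl2 cl2 ul2 lu2]] := rising_branch NL pr2 at2 vt2 vp2.
have [h1 [bh1 uh1 hu1]] := falling_branch NL pr1 at1 vt1 vn1.
have [h2 [bh2 uh2 hu2]] := falling_branch NL pr2 at2 vt2 vn2.
have l10 : l1 0 = a by rewrite -{1}(pr_ua pr1) lu1// lexx ltW.
have l20 : l2 0 = a by rewrite -{1}(pr_ua pr2) lu2// lexx ltW.
have cy1 s : 0 <= s -> {for s, continuous (fun s => v1 (l1 s))}.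
  by move=> s0; apply: (cont_comp (cl1 s s0)); exact: (pr_contv pr1).
have cy2 s : 0 <= s -> {for s, continuous (fun s => v2 (l2 s))}.
  by move=> s0; apply: (cont_comp (cl2 s s0)); exact: (pr_contv pr2).
have e12 : l1 0 = l2 0 by rewrite l10.
have l1_gt0 : 0 < l1 0 by rewrite l10.
have y10 : 0 < v1 (l1 0) by rewrite l10; exact: (profile_va NL pr1).
have y12 : v1 (l1 0) < v2 (l2 0) by rewrite l10 l20.
have M12 : u1 t1 < u2 t2.
  exact: (rising_max_lt NL bl1 bl2 cl1 cl2 cy1 cy2 e12 l1_gt0 y10 y12).
have bM1 := beta_lt_max NL bl1.
have SL s : beta <= s <= u1 t1 -> serrin 1 p f F l1 (fun s => v1 (l1 s)) s <
    serrin 1 p f F l2 (fun s => v2 (l2 s)) s.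
  exact: (rising_serrin_lt NL bl1 bl2 cl1 cl2 cy1 cy2 e12 l1_gt0 y10 y12).
have radial1 (sg : R) (u v r y : R -> R) s : u (r s) = s -> y s = sg * v (r s) ->
    sg ^+ 2 = 1 -> serrin sg p f F r y s = @radial_serrin R p f F u v (r s).
  move=> us ys sg2; rewrite /serrin /radial_serrin /flux us ys exprMn sg2 mul1r.
  congr (_ + _); set w := _ * v (r s); set G := F s / f s.
  by rewrite -[RHS]mul1r -sg2 /w; ring.
have l2h2 s s' : beta <= s -> s <= u1 t1 -> beta <= s' -> s' <= u1 t1 ->
    @radial_serrin R p f F u2 v2 (l2 s) <= @radial_serrin R p f F u2 v2 (h2 s').
  move=> bs sM bs' sM'.
  have [|/andP[als lst] uls] := ul2 s; first by lra.
  have [|ths uhs] := uh2 s'; first by lra.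
  (* Between the two radii [u2] rises and then falls, so it exceeds the smaller of its end
     values. *)
  have ub x : l2 s < x < h2 s' -> beta < u2 x.
    move=> /andP[lx xh]; have [xt|tx] := leP x t2.
      by have := rising_lt pr2 vp2 als lx xt; lra.
    by have := falling_lt pr2 at2 vn2 (ltW tx) xh; lra.
  apply: (radial_serrin_le NL pr2) => //; first by lra.
  move=> x /andP[]; rewrite le_eqVlt => /predU1P[<- _|lx]; first by lra.
  rewrite le_eqVlt => /predU1P[->|xh]; first by lra.
  by apply/ltW/ub; rewrite lx.
have bh (x : R) : beta <= x -> x <= u1 t1 ->
    serrin (-1) p f F h2 (fun s => - v2 (h2 s)) x =
    @radial_serrin R p f F u2 v2 (h2 x).
  move=> bx xM; have [|_ uhx] := uh2 x; first by lra.
  by apply: radial1; rewrite ?mulN1r ?sqrrN ?expr1n.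
have bl (x : R) : beta <= x -> x <= u1 t1 ->
    serrin 1 p f F l2 (fun s => v2 (l2 s)) x =
    @radial_serrin R p f F u2 v2 (l2 x).
  move=> bx xM; have [|_ ulx] := ul2 x; first by lra.
  by apply: radial1; rewrite ?mul1r ?expr1n.
apply: (falling_contradiction NL bh1 bh2 M12).
- by move=> c e; exact: (falling_decay pr2 at2 vn2 hu2).
- have := SL (u1 t1); rewrite (ltW bM1) lexx => /(_ isT).
  rewrite bh ?(ltW bM1)// bl ?(ltW bM1)//.
  have u10 : 0 < u1 t1 by lra.
  rewrite (radial1 1 u1 v1) ?mul1r ?expr1n//; last first.
    by have [|] := ul1 (u1 t1); rewrite ?lexx ?(ltW u10).
  rewrite (radial1 (-1) u1 v1) ?mulN1r ?sqrrN ?expr1n//; last first.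
    by have [|] := uh1 (u1 t1); rewrite ?lexx ?u10.
  rewrite lu1 ?lexx ?(ltW at1)// hu1// => /lt_le_trans; apply.
  by apply: l2h2; rewrite ?lexx ?(ltW bM1).
(* At [beta] on the rising branch the functional is [r^n v^2 > 0], and it only grows afterwards. *)
- move=> x /andP[bx xM]; rewrite bh//.
  apply: lt_le_trans (l2h2 beta x (lexx _) (ltW bM1) bx xM).
  have [|/andP[alb lbt] ulb] := ul2 beta; first by lra.
  rewrite /radial_serrin ulb (nl_Fbeta NL) !(mul0r, mulr0, addr0).
  rewrite mulr_gt0 ?exprn_gt0//; first by lra.
  apply: vp2; rewrite alb lt_neqAle lbt andbT; apply/eqP => e.
  by move: ulb; rewrite e; lra.
Qed.

End Uniqueness.

(** * Equal initial slopes *)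

Lemma gronwall_zero {R : realType} {w1 w2 : R -> R} {c d K : R} : c <= d ->
  (forall x, c <= x <= d -> {for x, continuous w1}) ->
  (forall x, c <= x <= d -> {for x, continuous w2}) ->
  (forall x, c < x < d -> exists2 l,
    is_derive x 1 w1 l & `|l| <= K * (`|w1 x| + `|w2 x|)) ->
  (forall x, c < x < d -> exists2 l,
    is_derive x 1 w2 l & `|l| <= K * (`|w1 x| + `|w2 x|)) ->
  w1 c = 0 -> w2 c = 0 -> forall x, c <= x <= d -> w1 x = 0 /\ w2 x = 0.
Proof.
move=> cd cw1 cw2 dw1 dw2 w1c w2c x /andP[cx xd].
(* The rate [4 * K] comes from [2 (w1 l1 + w2 l2) <= 2 K (|w1| + |w2|)^2 <= 4 K (w1^2 + w2^2)]. *)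
pose e z := expR (- (4 * K) * z).
have e_gt0 z : 0 < e z by exact: expR_gt0.
pose E z := (w1 z ^+ 2 + w2 z ^+ 2) * e z.
have : E x <= E c.
  apply: deriv_le0_ge => // z zx.
    have zcd : c <= z <= d by lra.
    have cexp : {for z, continuous e}.
      apply: (@cont_comp _ expR (fun z => - (4 * K) * z)).
        by continuity.
      exact: continuous_expR.
    by have := cw1 z zcd; have := cw2 z zcd => ? ?; rewrite /E; continuity.
  have zcd : c < z < d by lra.
  have [l1 d1 b1] := dw1 z zcd; have [l2 d2 b2] := dw2 z zcd.
  have dexp : is_derive z 1 e (e z * (- (4 * K) * 1)).
    exact: (@deriv_comp _ expR _ _ _ _ (is_derive_expR _)
      (deriv_scale (- (4 * K)) (deriv_id z))).
  eexists.
    exact: deriv_mul (deriv_add (deriv_sqr d1) (deriv_sqr d2)) dexp.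
  rewrite [leLHS](_ : _ = (2 * (w1 z * l1 + w2 z * l2) -
    4 * K * (w1 z ^+ 2 + w2 z ^+ 2)) * e z); last by ring.
  rewrite pmulr_lle0// subr_le0.
  have h1 : w1 z * l1 <= `|w1 z| * (K * (`|w1 z| + `|w2 z|)).
    by rewrite (le_trans (ler_norm _))// normrM ler_wpM2l.
  have h2 : w2 z * l2 <= `|w2 z| * (K * (`|w1 z| + `|w2 z|)).
    by rewrite (le_trans (ler_norm _))// normrM ler_wpM2l.
  rewrite -(real_normK (num_real (w1 z))) -(real_normK (num_real (w2 z))).
  have n1 := normr_ge0 (w1 z); have n2 := normr_ge0 (w2 z).
  have [n0|n0] := eqVneq (`|w1 z| + `|w2 z|) 0.
    have z1 : `|w1 z| = 0 by lra.
    have z2 : `|w2 z| = 0 by lra.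
    by move: h1 h2; rewrite z1 z2 !mul0r expr0n/=; lra.
  have K0 : 0 <= K.
    have n0' : 0 < `|w1 z| + `|w2 z| by rewrite lt_neqAle eq_sym n0; lra.
    by rewrite -(pmulr_lge0 _ n0') (le_trans (normr_ge0 l1)).
  have : 0 <= K * (`|w1 z| - `|w2 z|) ^+ 2 by rewrite mulr_ge0// sqr_ge0.
  by lra.
rewrite {2}/E w1c w2c expr0n/= addr0 mul0r pmulr_lle0// => w0.
have s1 := sqr_ge0 (w1 x); have s2 := sqr_ge0 (w2 x).
by split; apply/eqP; rewrite -sqrf_eq0; apply/eqP; lra.
Qed.

Lemma cont_bounded {R : realType} {g : R -> R} {c d : R} : c <= d ->
  (forall x, c <= x <= d -> {for x, continuous g}) ->
  exists K, forall x, c <= x <= d -> `|g x| <= K.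
Proof.
move=> cd cg.
have [z _ hz] := EVT_max cd (continuous_within_cc _ _ _
  (fun x xcd => cont_comp (cg x xcd) (@norm_continuous _ _ (g x)))).
by exists `|g z| => x xcd; apply: hz; rewrite in_itv.
Qed.

Section Uniqueness.
Context {R : realType} {p : nat} {f F : R -> R} {B beta : R}.
Hypothesis NL : nonlinearity R p f F B beta.
Hypothesis f_C1 : forall s : R, 0 < s ->
  derivable f s 1 /\ {for s, continuous f^`()}.
Context {a : R} {u1 v1 u2 v2 : R -> R}.
Hypothesis pr1 : profile R p f a u1 v1.
Hypothesis pr2 : profile R p f a u2 v2.
Hypothesis va12 : v1 a = v2 a.

Let lipschitz {c d : R} : 0 < c -> c <= d ->
  exists2 K, 0 <= K & forall x y, c <= x <= d -> c <= y <= d ->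
    `|f x - f y| <= K * `|x - y|.
Proof.
move=> c0 cd; have [|K hK] := @cont_bounded _ f^`() c d cd.
  by move=> x xcd; have [|//] := f_C1 x; lra.
exists K; first by apply: le_trans (hK c _); rewrite ?lexx.
have main x y : c <= x -> x <= y -> y <= d -> `|f y - f x| <= K * `|y - x|.
  move=> cx xy yd.
  have df z : c <= z -> is_derive z 1 f (f^`() z).
    move=> cz; have [|dz _] := f_C1 z; first by lra.
    by rewrite derive1E; exact: derivableP.
  have [z zxy ->] : exists2 z, z \in `[x, y]%R & f y - f x = derive1 f z * (y - x).
    apply: MVT_segment => //.
      by move=> z; rewrite in_itv/= => zxy; apply: df; lra.
    by apply: continuous_within_cc => z zxy; apply: deriv_continuous (df z _); lra.
  by rewrite normrM ler_wpM2r// hK//; move: zxy; rewrite in_itv/=; lra.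
move=> x y xcd ycd; have [xy|yx] := leP x y; last by apply: main; lra.
by rewrite distrC (distrC x); apply: main; lra.
Qed.

(* The nonlinearity is not Lipschitz near 0, but with u as the variable it
   drops out of the equations for the difference of two branches. *)
Let equal_near : exists2 c, a < c & (forall r, a <= r <= c -> u1 r = u2 r) /\
  v1 c = v2 c.
Proof.
have a0 := pr_a pr1.
have [t1 [at1 vt1 vp1 vn1]] := profile_peak NL pr1.
have [t2 [at2 vt2 vp2 vn2]] := profile_peak NL pr2.
have [l1 [bl1 cl1 ul1 lu1]] := rising_branch NL pr1 at1 vt1 vp1.
have [l2 [bl2 cl2 ul2 lu2]] := rising_branch NL pr2 at2 vt2 vp2.
have l10 : l1 0 = a by rewrite -{1}(pr_ua pr1) lu1// lexx ltW.
have l20 : l2 0 = a by rewrite -{1}(pr_ua pr2) lu2// lexx ltW.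
have b0 := nl_beta_gt0 NL.
have bM1 := beta_lt_max NL bl1; have bM2 := beta_lt_max NL bl2.
pose y1 s := v1 (l1 s); pose y2 s := v2 (l2 s).
have cy1 s : 0 <= s -> {for s, continuous y1}.
  by move=> s0; apply: (cont_comp (cl1 s s0)); exact: (pr_contv pr1).
have cy2 s : 0 <= s -> {for s, continuous y2}.
  by move=> s0; apply: (cont_comp (cl2 s s0)); exact: (pr_contv pr2).
have y1_gt0 s : 0 <= s <= beta -> 0 < y1 s.
  move=> sb; have [|/andP[als lst] uls] := ul1 s; first by lra.
  by apply: vp1; rewrite als lt_neqAle lst andbT; apply/eqP => e; move: uls; rewrite e; lra.
have y2_gt0 s : 0 <= s <= beta -> 0 < y2 s.
  move=> sb; have [|/andP[als lst] uls] := ul2 s; first by lra.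
  by apply: vp2; rewrite als lt_neqAle lst andbT; apply/eqP => e; move: uls; rewrite e; lra.
have l1_gt0 s : 0 <= s <= beta -> 0 < l1 s.
  by move=> sb; have [|] := ul1 s; lra.
have l2_gt0 s : 0 <= s <= beta -> 0 < l2 s.
  by move=> sb; have [|] := ul2 s; lra.
(* The difference [w] of the energies and the difference [z] of the radii satisfy [w' = A w + C z]
   and [z' = D w], with coefficients bounded on [[0, beta]]. *)
pose A s := - (2 * p.+1%:R) * ((y1 s + y2 s) * l1 s)^-1.
pose C s := 2 * p.+1%:R * (y2 s * (l1 s * l2 s)^-1).
pose D s := - (y1 s * y2 s * (y1 s + y2 s))^-1.
have [K1 hK1] : exists K, forall s, 0 <= s <= beta -> `|A s| <= K.
  apply: cont_bounded; first exact: ltW.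
  move=> s sb; have s0 : 0 <= s by lra.
  have := cy1 s s0; have := cy2 s s0; have := cl1 s s0; have := cl2 s s0.
  have := y1_gt0 s sb; have := y2_gt0 s sb; have := l1_gt0 s sb => ? ? ? ? ? ? ?.
  rewrite /A; apply: cont_mul; [exact: cont_cst|apply: cont_inv; [|by continuity]].
  by rewrite gt_eqF// mulr_gt0// addr_gt0.
have [K2 hK2] : exists K, forall s, 0 <= s <= beta -> `|C s| <= K.
  apply: cont_bounded; first exact: ltW.
  move=> s sb; have s0 : 0 <= s by lra.
  have := cy1 s s0; have := cy2 s s0; have := cl1 s s0; have := cl2 s s0.
  have := l2_gt0 s sb; have := l1_gt0 s sb => ? ? ? ? ? ?.
  rewrite /C; apply: cont_mul; [exact: cont_cst|apply: cont_mul => //].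
  by apply: cont_inv; [rewrite gt_eqF// mulr_gt0|continuity].
have [K3 hK3] : exists K, forall s, 0 <= s <= beta -> `|D s| <= K.
  apply: cont_bounded; first exact: ltW.
  move=> s sb; have s0 : 0 <= s by lra.
  have := cy1 s s0; have := cy2 s s0.
  have := y1_gt0 s sb; have := y2_gt0 s sb => ? ? ? ?.
  rewrite /D; apply: cont_opp; apply: cont_inv; [|by continuity].
  by rewrite gt_eqF// !mulr_gt0// addr_gt0.
pose K := Num.max K1 (Num.max K2 K3).
have K1K : K1 <= K by rewrite /K le_max lexx.
have K2K : K2 <= K by rewrite /K !le_max lexx orbT.
have K3K : K3 <= K by rewrite /K !le_max lexx !orbT.
have bb : 0 <= beta by exact: ltW.
have eqs : forall s, 0 <= s <= beta ->
    (y1 s ^+ 2 + 2 * F s) - (y2 s ^+ 2 + 2 * F s) = 0 /\ l1 s - l2 s = 0.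
  apply: (@gronwall_zero _ _ _ 0 beta K bb).
  - move=> s /andP[s0 _]; have := cy1 s s0; have := cy2 s s0.
    by have := nl_contF NL s0 => ? ? ?; continuity.
  - by move=> s /andP[s0 _]; have := cl1 s s0; have := cl2 s s0 => ? ?; continuity.
  - move=> s sb; have s1 : 0 < s < u1 t1 by lra. have s2 : 0 < s < u2 t2 by lra.
    have sb' : 0 <= s <= beta by lra.
    eexists.
      exact: deriv_sub (deriv_energy NL bl1 s1) (deriv_energy NL bl2 s2).
    rewrite -/(y1 s) -/(y2 s) (_ : _ - _ = A s * ((y1 s ^+ 2 + 2 * F s) -
      (y2 s ^+ 2 + 2 * F s)) + C s * (l1 s - l2 s)).
      apply: le_trans (ler_normD _ _) _; rewrite (normrM (A s)) (normrM (C s)) mulrDr lerD//.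
        by apply: ler_wpM2r => //; exact: le_trans (hK1 s sb') K1K.
      by apply: ler_wpM2r => //; exact: le_trans (hK2 s sb') K2K.
    have h1 := y1_gt0 s sb'; have h2 := y2_gt0 s sb'.
    have := l1_gt0 s sb'; have := l2_gt0 s sb' => ? ?.
    rewrite /y1 /y2 in h1 h2 *; rewrite /A /C /y1 /y2; field.
    by rewrite !gt_eqF// addr_gt0.
  - move=> s sb; have s1 : 0 < s < u1 t1 by lra. have s2 : 0 < s < u2 t2 by lra.
    have sb' : 0 <= s <= beta by lra.
    eexists; first exact: deriv_sub (br_derr bl1 s1) (br_derr bl2 s2).
    rewrite -/(y1 s) -/(y2 s) (_ : _ - _ = D s * ((y1 s ^+ 2 + 2 * F s) -
      (y2 s ^+ 2 + 2 * F s))).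
      rewrite (normrM (D s)) mulrDr.
      have h : `|D s| <= K by exact: le_trans (hK3 s sb') K3K.
      have K0 : 0 <= K by exact: le_trans (normr_ge0 _) h.
      rewrite -[leLHS]addr0; apply: lerD; first exact: ler_wpM2r.
      exact: mulr_ge0.
    have h1 := y1_gt0 s sb'; have h2 := y2_gt0 s sb'.
    rewrite /y1 /y2 in h1 h2 *; rewrite /D /y1 /y2; field.
    by rewrite !gt_eqF// addr_gt0.
  - by rewrite /y1 /y2 l10 l20 va12 subrr.
  - by rewrite l10 l20 subrr.
have leq s : 0 <= s <= beta -> l1 s = l2 s.
  by move=> sb; have [_] := eqs s sb; lra.
have bb' : 0 <= beta <= beta by rewrite bb lexx.
have [|/andP[al1 l1t] ul1b] := ul1 beta; first by lra.
have [|_ ul2b] := ul2 beta; first by lra.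
have alb : a < l1 beta.
  by rewrite lt_neqAle al1 andbT; apply/eqP => e; move: ul1b; rewrite -e (pr_ua pr1); lra.
exists (l1 beta) => //; split.
  move=> r /andP[ar rl].
  have s0 : 0 <= u1 r := profile_ge0 pr1 ar.
  have sb : u1 r <= beta.
    move: rl; rewrite le_eqVlt => /predU1P[->|rl]; first by rewrite ul1b.
    by rewrite -ul1b ltW// (rising_lt pr1 vp1 ar rl l1t).
  have sb' : 0 <= u1 r <= beta by rewrite s0.
  (* Here [r = l1 (u1 r) = l2 (u1 r)], and applying [u2] yields [u1 r]. *)
  have := leq (u1 r) sb'; rewrite lu1; last by rewrite ar (le_trans rl).
  by move=> {2}->; have [|_ ->//] := ul2 (u1 r); lra.
have [h _] := eqs beta bb'.
have : y1 beta ^+ 2 = y2 beta ^+ 2 by lra.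
have := y1_gt0 beta bb'; have := y2_gt0 beta bb' => h2 h1.
move=> /(congr1 Num.sqrt); rewrite !sqrtr_sqr !gtr0_norm// /y1 /y2 => ->.
by rewrite leq.
Qed.

(** Beyond [c] both solutions stay above a positive minimum on [[c, r]], where [f] is Lipschitz, and
    Gronwall applies to the first-order system for [u] and [v]. *)
Lemma profile_unique {r : R} : a <= r -> u1 r = u2 r.
Proof.
move=> ar; have a0 := pr_a pr1; have [c ac [ueq veq]] := equal_near.
have [rc|cr] := leP r c; first by apply: ueq; rewrite ar.
have cr' : c <= r by exact: ltW.
have [z1] := EVT_min cr' (continuous_within_cc _ _ _ (fun x _ => pr_contu pr1 x)).
rewrite in_itv/= => z1cr m1.
have [z2] := EVT_min cr' (continuous_within_cc _ _ _ (fun x _ => pr_contu pr2 x)).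
rewrite in_itv/= => z2cr m2.
have [k1] := EVT_max cr' (continuous_within_cc _ _ _ (fun x _ => pr_contu pr1 x)).
rewrite in_itv/= => _ M1.
have [k2] := EVT_max cr' (continuous_within_cc _ _ _ (fun x _ => pr_contu pr2 x)).
rewrite in_itv/= => _ M2.
pose m := Num.min (u1 z1) (u2 z2); pose M := Num.max (u1 k1) (u2 k2).
have m0 : 0 < m.
  by rewrite lt_min; apply/andP; split; [apply: (pr_pos pr1)|apply: (pr_pos pr2)]; lra.
have u1m x : c <= x <= r -> m <= u1 x <= M.
  move=> xcr; rewrite /m /M ge_min le_max.
  by rewrite m1 ?in_itv// M1 ?in_itv.
have u2m x : c <= x <= r -> m <= u2 x <= M.
  move=> xcr; rewrite /m /M ge_min le_max.
  by rewrite m2 ?in_itv// M2 ?in_itv// !orbT.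
have mM : m <= M by have := u1m c; rewrite lexx cr' => /(_ isT) /andP[]; exact: le_trans.
have [L L0 hL] := lipschitz m0 mM.
(* The summands bound the coefficients coming from [u' = v], from [f] and from the damping term. *)
pose K := 1 + L + p.+1%:R / c.
have q0 : 0 <= p.+1%:R / c by rewrite divr_ge0//; lra.
have : u1 r - u2 r = 0 /\ v1 r - v2 r = 0.
  apply: (@gronwall_zero _ (fun x => u1 x - u2 x) (fun x => v1 x - v2 x) c r K cr').
  - move=> x _; have := pr_contu pr1 x; have := pr_contu pr2 x => ? ?.
    by continuity.
  - move=> x _; have := pr_contv pr1 x; have := pr_contv pr2 x => ? ?.
    by continuity.
  - move=> x xcr; have ax : a < x by lra.
    eexists; first exact: deriv_sub (pr_du pr1 ax) (pr_du pr2 ax).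
    have := normr_ge0 (u1 x - u2 x); have := normr_ge0 (v1 x - v2 x).
    set w := `|u1 x - u2 x|; set z := `|v1 x - v2 x| => z0 w0.
    rewrite -subr_ge0 (_ : _ - _ = w + (L + p.+1%:R / c) * (w + z)); last first.
      by rewrite /K; ring.
    by rewrite addr_ge0// mulr_ge0; lra.
  - move=> x xcr; have ax : a < x by lra.
    eexists; first exact: deriv_sub (pr_dv pr1 ax) (pr_dv pr2 ax).
    have fl := hL (u1 x) (u2 x) _ _.
    have {}fl : `|f (u1 x) - f (u2 x)| <= L * `|u1 x - u2 x|.
      by apply: fl; [apply: u1m|apply: u2m]; lra.
    have w0 := normr_ge0 (u1 x - u2 x); have z0 := normr_ge0 (v1 x - v2 x).
    have qx : p.+1%:R / x <= p.+1%:R / c.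
      by rewrite ler_wpM2l// lef_pV2 ?posrE; lra.
    have qx0 : 0 <= p.+1%:R / x by rewrite divr_ge0//; lra.
    rewrite [X in `|X|](_ : _ = - (p.+1%:R / x * (v1 x - v2 x) +
      (f (u1 x) - f (u2 x)))); last by ring.
    rewrite normrN; apply: le_trans (ler_normD _ _) _.
    rewrite normrM (ger0_norm qx0).
    have qz := ler_wpM2r z0 qx.
    have Lz := mulr_ge0 L0 z0; have qw := mulr_ge0 q0 w0.
    by rewrite /K !mulrDl !mulrDr !mul1r; lra.
  - by rewrite ueq ?subrr// lexx ltW.
  - by rewrite veq subrr.
  - by rewrite cr' lexx.
by move=> [h _]; lra.
Qed.

End Uniqueness.

(** * Solutions and their profiles *)

Section Extension.
Context {R : realType}.
Implicit Types (g : R -> R) (a r : R).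

Lemma cont_max_at g a : g x @[x --> a^'+] --> g a ->
  {for a, continuous (fun r => g (Num.max a r))}.
Proof.
move=> /cvgrPdist_lt ga; apply/cvgrPdist_lt => e e0.
have [d /= d0 hd] := ga e e0.
exists d => //= z az; rewrite max_l//.
have [za|az'] := leP z a; first by rewrite subrr normr0.
exact: hd.
Qed.

Lemma deriv_max g a r l : a < r -> is_derive r 1 g l ->
  is_derive r 1 (fun r => g (Num.max a r)) l.
Proof.
move=> ar; apply: near_eq_is_derive.
near=> z; rewrite max_r// ltW//; near: z; exact: lt_nbhsr.
Unshelve. all: by end_near. Qed.

Lemma cont_max g a : g x @[x --> a^'+] --> g a ->
  (forall r, a < r -> derivable g r 1) ->
  forall r, {for r, continuous (fun r => g (Num.max a r))}.
Proof.
move=> ga dg r; have [ra|ar|->] := ltgtP r a; last exact: cont_max_at.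
  apply: (@deriv_continuous _ _ _ 0).
  apply: near_eq_is_derive (is_derive_cst (g a) r 1).
  near=> z; rewrite /cst max_l// ltW//; near: z; exact: lt_nbhsl.
by apply: deriv_continuous; apply: deriv_max => //; apply: derivableP; exact: dg.
Unshelve. all: by end_near. Qed.

Lemma within_at_right g a : {within `[a, +oo[, continuous g} ->
  g x @[x --> a^'+] --> g a.
Proof.
move=> /subspace_continuousP/(_ a) /=; rewrite in_itv/= lexx => /(_ isT) ga.
apply/cvgrPdist_lt => e e0; move/cvgrPdist_lt : ga => /(_ e e0)[d /= d0 hd].
by exists d => // z az az'; apply: hd => //=; rewrite in_itv/= andbT ltW.
Qed.

Lemma quotient_at_right g a (l : R) : (g (a + h) - g a) / h @[h --> 0^'+] --> l ->
  g x @[x --> a^'+] --> g a.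
Proof.
move=> gl; apply/cvgrPdist_lt => e e0.
have /cvgrPdist_lt/(_ 1 ltr01)[d1 /= d10 h1] := gl.
pose d := Num.min d1 (e / (`|l| + 1)).
have l1 : 0 < `|l| + 1 by have := normr_ge0 l; lra.
have d0 : 0 < d by rewrite lt_min d10 divr_gt0.
exists d => //= z zd az; have za0 : 0 < z - a by rewrite subr_gt0.
have : `|z - a| < d by rewrite distrC.
rewrite (gtr0_norm za0) lt_min => /andP[zd1 zd2].
have := h1 (z - a); rewrite /= sub0r normrN gtr0_norm// => /(_ zd1 za0).
rewrite (addrC a) subrK => h2; rewrite distrC.
rewrite -[g z - g a](@divfK _ (z - a)) ?gt_eqF// normrM (gtr0_norm za0).
have q : `|(g z - g a) / (z - a)| <= `|l| + 1.
  have := ler_normB l (l - (g z - g a) / (z - a)).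
  by rewrite subKr; lra.
apply: (@le_lt_trans _ _ ((`|l| + 1) * (z - a))); first by rewrite ler_pM2r.
by rewrite mulrC -ltr_pdivlMr.
Qed.

End Extension.

Lemma primitive0_nonlinearity {R : realType} {p : nat} {f : R -> R}
    {B beta : R} : {within `[0, +oo[, continuous f} -> C1_oy 0 f ->
  0 < B -> B < beta -> (forall s : R, B < s -> 0 < f s) ->
  (forall s : R, 0 <= s <= B -> f s <= 0) -> primitive0 f beta = 0 ->
  (forall s : R, beta < s -> (p.+2%:R - 2) / (2 * p.+2%:R) <=
     (fun t => primitive0 f t / f t)^`()%classic s) ->
  nonlinearity R p f (primitive0 f) B beta.
Proof.
move=> cf f1 B0 Bb fpos fneg Fb FK.
(* The integral over an empty interval is 0, so the primitive vanishes at negative arguments and its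
   continuity at 0 is two-sided. *)
have Fle0 (s : R) : s <= 0 -> primitive0 f s = 0.
  rewrite le_eqVlt => /predU1P[->|s0]; rewrite /primitive0.
    by rewrite set_itv1 Rintegral_set1.
  by rewrite set_itv_ge ?Rintegral_set0// bnd_simp -ltNge.
have fint u : (@lebesgue_measure R).-integrable `[0, u] (EFin \o f).
  apply: continuous_compact_integrable; first exact: segment_compact.
  apply: continuous_subspaceW cf => x /=; rewrite !in_itv/= => /andP[->//].
have fc (s : R) : 0 < s -> {for s, continuous f}.
  by move=> s0; exact: deriv_continuous (derivableP (f1 s s0).1).
have dF (s : R) : 0 < s -> is_derive s 1 (primitive0 f) (f s).
  move=> s0; have ss : s < s + 1 by lra.
  have [d1 d2] := continuous_FTC1_closed ss (fint (s + 1)) s0 (fc s s0).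
  by split; [exact: d1|rewrite -derive1E; exact: d2].
split=> //.
- exact: Fle0.
- move=> s; rewrite le_eqVlt => /predU1P[<-|s0]; last exact: deriv_continuous (dF s s0).
  rewrite (_ : primitive0 f = fun s => primitive0 f (Num.max 0 s)).
    rewrite /=; apply: cont_max_at.
    have := parameterized_integral_continuous ler01 (fint 1).
    by move=> /(continuous_within_itvP _ ltr01)[].
  apply/funext => s'; have [s0|s0] := leP s' 0; first by rewrite !Fle0.
  by [].
move=> s bs; have s0 : 0 < s by lra.
have fs : f s != 0 by rewrite gt_eqF// fpos//; lra.
(* The bound [FK] concerns the value of a derivative; the quotient rule supplies the
   differentiability behind it. *)
have dG := deriv_mul (dF s s0) (deriv_inv fs (derivableP (f1 s s0).1)).
exists ((fun t => primitive0 f t / f t)^`()%classic s).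
  by rewrite derive1E; apply: derivableP; case: dG.
have n0 : 0 < 2 * p.+2%:R :> R by rewrite mulr_gt0.
have := FK s bs; rewrite ler_pdivrMr// mulrC; apply: le_trans.
by rewrite -!natr1; lra.
Qed.

Lemma solution_profile {R : realType} {p : nat} {f : R -> R} {a : R}
    {u : R -> R} : 0 < a -> positive_solution p.+2 f a u -> exists v,
  profile R p f a (fun r => u (Num.max a r)) v.
Proof.
move=> a0 [[u2 [du [du1 dua cdu]]] upos ode ua ulim].
have u1E r : a < r -> u^`()%classic r = du r.
  by move=> ar; rewrite derive1E (@derive_val _ _ _ _ _ _ _ (du1 r ar)).
have ddu r : a < r -> is_derive r 1 du (- (p.+1%:R / r) * du r - f (u r)).
  move=> ar; have [_ d2 _] := u2 r ar.
  have -> : - (p.+1%:R / r) * du r - f (u r) = u^`(2)%classic r.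
    have := ode r ar; rewrite u1E// (_ : p.+2%:R - 1 = p.+1%:R :> R); first by lra.
    by rewrite -natr1 addrK.
  apply: near_eq_is_derive (_ : is_derive r 1 u^`()%classic _).
    near=> z; apply: u1E; near: z; exact: lt_nbhsr.
  by rewrite derive1nS derive1E; exact: derivableP.
(* Both functions are continued to the left of [a] by their values at [a], where one-sided
   continuity suffices. *)
exists (fun r => du (Num.max a r)); split=> //.
- apply: cont_max; first exact: quotient_at_right dua.
  by move=> r /du1 [].
- by apply: cont_max; [exact: within_at_right|move=> r /ddu []].
- by move=> r ar; rewrite max_r ?ltW//; apply: deriv_max => //; exact: du1.
- by move=> r ar; rewrite max_r ?ltW//; apply: deriv_max => //; exact: ddu.
- by rewrite max_l.
- by move=> r ar; rewrite max_r ?ltW// upos.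
- move=> e e0; move/cvgrPdist_lt : ulim => /(_ e e0) [M [_ hM]].
  exists (M + 1) => r Mr; have := hM (Num.max a r).
  rewrite lt_max; have -> : M < r by lra.
  by rewrite orbT => /(_ isT); rewrite sub0r normrN; apply: le_lt_trans; exact: ler_norm.
Unshelve. all: by end_near. Qed.

Theorem theorem1p2 (R : realType) (n : nat) (f : R -> R) (B beta : R)
  (hn : (2 <= n)%N)
  (f_cont : {within `[0, +oo[, continuous f})
  (f_C1 : C1_oy 0 f)
  (f'_L1 : (@lebesgue_measure R).-integrable `]0, 1[ (EFin \o f^`()))
  (f0 : f 0 = 0)
  (B_gt0 : 0 < B)
  (B_lt_beta : B < beta)
  (f_pos : forall s : R, B < s -> 0 < f s)
  (f_nonpos : forall s : R, 0 <= s <= B -> f s <= 0)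
  (f_neg0 : exists2 eps : R, 0 < eps & forall s : R, 0 < s < eps -> f s < 0)
  (F_beta : primitive0 f beta = 0)
  (F_over_f : forall s : R, beta < s ->
     (n%:R - 2) / (2 * n%:R) <= (fun t => primitive0 f t / f t)^`()%classic s)
  (a : R) (a_gt0 : 0 < a) (u1 u2 : R -> R) :
  positive_solution n f a u1 -> positive_solution n f a u2 ->
  forall r : R, a <= r -> u1 r = u2 r.
Proof.
case: n hn F_over_f => [|[|p]]// _ FK /(solution_profile a_gt0)[v1 pr1].
move=> /(solution_profile a_gt0)[v2 pr2] r ar.
have NL := primitive0_nonlinearity f_cont f_C1 B_gt0 B_lt_beta f_pos f_nonpos
  F_beta FK.
have va : v1 a = v2 a.
  apply/eqP; rewrite eq_le !leNgt.
  by apply/andP; split; apply/negP; [exact: (initial_slope_not_lt NL pr2 pr1)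
    |exact: (initial_slope_not_lt NL pr1 pr2)].
by have := profile_unique NL f_C1 pr1 pr2 va ar; rewrite max_r.
Qed.
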